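(* Let $N$ be an integer with $3\leq N\leq 9$, let $B_1\subset\mathbb{R}^N$ be the unit ball, and let $1\leq q<p\leq\infty$ with $p>\frac{N}{N-2}$. Then there exist a sequence of nonnegative, nondecreasing functions $\{f_n\}_{n\in\mathbb{N}}\subset C^\infty(\mathbb{R})$ and a sequence $\{u_n\}_{n\in\mathbb{N}}\subset C^\infty(\overline{B_1})$ such that, for every $n\in\mathbb{N}$, $u_n$ is a solution of the Dirichlet problem $$-\Delta u_n=f_n(u_n)\ \text{ in } B_1,\qquad u_n=0\ \text{ on }\partial B_1,$$ with radial Morse index $ind_r(u_n)=1$ in $B_1$, and $$\frac{\|u_n\|_{L^p(B_1)}}{\|u_n\|_{L^q(B_1)}}\longrightarrow+\infty\quad\text{as } n\to\infty.$$
   Context: $B_1$ denotes the open unit ball of $\mathbb{R}^N$ centered at the origin. $C^1_{0,rad}(B_1)$ denotes the space of radially symmetric functions in $C^1_0(B_1)$, where $C^1_0(B_1)$ is the space of $C^1$ functions with compact support in $B_1$. For a solution $u$ of $-\Delta u=f(u)$ in $B_1$, $u=0$ on $\partial B_1$, with $f\in C^1(\mathbb{R})$ and $f'(u)\in L^1_{loc}(B_1)$, the radial Morse index $ind_r(u)$ of $u$ in $B_1$ equals $k$ if $k$ is the maximal dimension of a linear subspace $X_k\subset C^1_{0,rad}(B_1)$ such that $$\int_{B_1}\left(|\nabla\varphi|^2-f'(u)\varphi^2\right)dx<0\quad\text{for all }\varphi\in X_k\setminus\{0\}.$$ *)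

(* Defs.v *)
From HB Require Import structures.
From mathcomp Require Import all_boot all_order all_algebra.
From mathcomp Require Import all_classical all_reals all_analysis.

Set Implicit Arguments.
Unset Strict Implicit.
Unset Printing Implicit Defensive.

Import Order.TTheory GRing.Theory Num.Theory.
Import numFieldNormedType.Exports.

Local Open Scope classical_set_scope.
Local Open Scope ring_scope.

Definition rV_display : measure_display.
Proof. exact. Qed.

Section measurable_rV.
Context {R : realType} (n : nat).

(* The sigma-algebra generated by the coordinates, that is, the Borel sets. *)
Let coord (i : 'I_n) (x : 'rV[R]_n) : measurableTypeR R := x ord0 i.

Let rV_set0 : g_sigma_preimage coord set0.
Proof. exact: sigma_algebra0. Qed.

Let rV_setC A : g_sigma_preimage coord A -> g_sigma_preimage coord (~` A).
Proof. exact: sigma_algebraC. Qed.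

Let rV_bigcup (F : (set 'rV[R]_n)^nat) :
  (forall i, g_sigma_preimage coord (F i)) ->
  g_sigma_preimage coord (\bigcup_i (F i)).
Proof. exact: sigma_algebra_bigcup. Qed.

HB.instance Definition _ := @isMeasurable.Build rV_display
  'rV[R]_n (g_sigma_preimage coord) rV_set0 rV_setC rV_bigcup.
End measurable_rV.

Section lebesgue_rV.
Context {R : realType}.
Implicit Type n : nat.

Definition cons_rV n (z : measurableTypeR R * 'rV[R]_n) : 'rV[R]_n.+1 :=
  \row_i (if unlift ord0 i is Some j then z.2 ord0 j else z.1).

Lemma measurable_coord n (i : 'I_n) :
  measurable_fun setT (fun x : 'rV[R]_n => x ord0 i : measurableTypeR R).
Proof.
move=> _ Y mY; rewrite setTI; apply: sub_sigma_algebra => /=.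
rewrite -bigcup_seq/=; exists i => /=; first by rewrite mem_index_enum.
by exists Y => //; rewrite setTI.
Qed.

Lemma measurable_rV d (T : measurableType d) n (f : T -> 'rV[R]_n) :
  (forall i, measurable_fun setT (fun t => f t ord0 i : measurableTypeR R)) ->
  measurable_fun setT f.
Proof.
move=> mf; have mS : g_sigma_preimage
    (fun i t => f t ord0 i : measurableTypeR R) `<=` measurable.
  apply: smallest_sub; first exact: sigma_algebra_measurable.
  case: n => [|n] in f mf *; first by rewrite big_ord0.
  rewrite -bigcup_mkord_ord; apply: bigcup_sub => i Ii.
  by move=> A [B mB <-]; exact: mf.
move=> _ A mA; apply: mS.
have := @g_sigma_preimage_comp _ (measurableTypeR R) n 'rV[R]_n
  (fun i x => x ord0 i) _ f.
by rewrite /comp => ->; exists A.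
Qed.

Lemma measurable_cons_rV n : measurable_fun setT (@cons_rV n).
Proof.
apply: measurable_rV => i; rewrite /cons_rV.
case: (unliftP ord0 i) => [j ->|->].
  under eq_fun do rewrite mxE liftK.
  exact: (measurableT_comp (measurable_coord j)).
under eq_fun do rewrite mxE unlift_none.
exact: measurable_fst.
Qed.

Definition uncons_rV n (x : 'rV[R]_n.+1) : measurableTypeR R * 'rV[R]_n :=
  (x ord0 ord0, \row_j x ord0 (lift ord0 j)).

Lemma cons_rVK n : cancel (@cons_rV n) (@uncons_rV n).
Proof.
move=> [a x]; rewrite /uncons_rV /cons_rV mxE unlift_none; congr pair.
by apply/rowP => j; rewrite !mxE liftK.
Qed.

Lemma measurable_uncons_rV n : measurable_fun setT (@uncons_rV n).
Proof.
apply: measurable_fun_pair; first exact: measurable_coord.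
apply: measurable_rV => i; under eq_fun do rewrite mxE.
exact: measurable_coord.
Qed.

Section lebesgue_cons.
Variables (n : nat) (m : {sigma_finite_measure set 'rV[R]_n -> \bar R}).

Definition lebesgue_cons : set 'rV[R]_n.+1 -> \bar R :=
  pushforward (@lebesgue_measure R \x m)%E (@cons_rV n).

Let push := @measure_function_pushforward__canonical__measure_function_Measure
  _ _ _ _ _ (@lebesgue_measure R \x m)%E _ (@measurable_cons_rV n).

HB.instance Definition _ := isMeasure.Build _ _ _ lebesgue_cons
  (measure0 push) (measure_ge0 push) (@measure_semi_sigma_additive _ _ _ push).

Let lebesgue_cons_sigma_finite : sigma_finite setT lebesgue_cons.
Proof.
have /sigma_finiteP[F [FT ndF Foo]] := sigma_finiteT (@lebesgue_measure R).
have /sigma_finiteP[G [GT ndG Goo]] := sigma_finiteT m.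
exists (fun k => @uncons_rV n @^-1` (F k `*` G k)).
  apply/esym; rewrite -subTset => x _.
  have [k _ Fk] : (\bigcup_k F k) (uncons_rV x).1 by rewrite -FT.
  have [l _ Gl] : (\bigcup_k G k) (uncons_rV x).2 by rewrite -GT.
  exists (maxn k l) => //; split.
    by move/subsetPset : (ndF _ _ (leq_maxl k l)); exact.
  by move/subsetPset : (ndG _ _ (leq_maxr k l)); exact.
move=> k; have [mF Fk] := Foo k; have [mG Gk] := Goo k; split.
  rewrite -[X in measurable X]setTI; apply: measurable_uncons_rV => //.
  exact: measurableX.
rewrite /lebesgue_cons /pushforward -comp_preimage.
rewrite (_ : _ \o _ = id); last by apply/funext => z; exact: cons_rVK.
by rewrite preimage_id product_measure1E// lte_mul_pinfty// ge0_fin_numE.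
Qed.

HB.instance Definition _ := Measure_isSigmaFinite.Build _ _ _ lebesgue_cons
  lebesgue_cons_sigma_finite.

End lebesgue_cons.

(* N-dimensional Lebesgue measure as an iterated product measure; it is
   characterized by lebesgue_rV_box. *)
Fixpoint lebesgue_rV n : {sigma_finite_measure set 'rV[R]_n -> \bar R} :=
  if n is n'.+1 then lebesgue_cons (lebesgue_rV n') else dirac (0 : 'rV[R]_0).

Lemma lebesgue_rV_box n (A : 'I_n -> set (measurableTypeR R)) :
  (forall i, measurable (A i)) ->
  lebesgue_rV n [set x | forall i, A i (x ord0 i)] =
  (\prod_(i < n) lebesgue_measure (A i))%E.
Proof.
elim: n A => [|n IH] A mA.
  rewrite big_ord0 /= diracE mem_set//=.
  by move=> [].
rewrite big_ord_recl /= -IH//.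
have mB : measurable [set x : 'rV[R]_n | forall i, A (lift ord0 i) (x ord0 i)].
  rewrite (_ : mkset _ = \bigcap_(i in [set: 'I_n])
      ((fun x : 'rV[R]_n => x ord0 i : measurableTypeR R) @^-1`
        A (lift ord0 i))); last first.
    by apply/seteqP; split=> [x Ax i _|x Ax i]; [exact: Ax|exact: Ax].
  apply: fin_bigcap_measurable => // i _.
  by rewrite -[X in measurable X]setTI; exact: measurable_coord.
rewrite -product_measure1E// /lebesgue_cons /pushforward.
congr (product_measure1 _ _ _).
apply/seteqP; split=> -[a x] /=; rewrite /cons_rV.
  move=> Ax; split=> [|i]; first by have := Ax ord0; rewrite mxE unlift_none.
  by have := Ax (lift ord0 i); rewrite mxE liftK.
move=> [Aa Ax] i; rewrite mxE; case: (unliftP ord0 i) => [j ->|->//].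
exact: Ax.
Qed.
End lebesgue_rV.

Section calculus.
Context {R : realType}.

(* The Euclidean norm: the library norm `|x| on 'rV[R]_N is the sup norm,
   which only provides the (equivalent) topology. *)
Definition enorm N (x : 'rV[R]_N) : R := Num.sqrt (\sum_i x ord0 i ^+ 2).

Definition unit_ball N : set 'rV[R]_N := [set x | enorm x < 1].

Definition unit_sphere N : set 'rV[R]_N := [set x | enorm x = 1].

Definition smooth (f : R -> R) : Prop :=
  forall (k : nat) t, derivable (derive1n k f) t 1.

Definition base N (i : 'I_N) : 'rV[R]_N := delta_mx ord0 i.

Definition partial N (i : 'I_N) (u : 'rV[R]_N -> R) : 'rV[R]_N -> R :=
  fun x => 'D_(base i) u x.

Definition partials N (s : seq 'I_N) (u : 'rV[R]_N -> R) : 'rV[R]_N -> R :=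
  foldr (@partial N) u s.

Definition grad N (u : 'rV[R]_N -> R) (x : 'rV[R]_N) : 'rV[R]_N :=
  \row_i partial i u x.

Definition laplacian N (u : 'rV[R]_N -> R) (x : 'rV[R]_N) : R :=
  \sum_i partial i (partial i u) x.

(* u belongs to C^oo of the closure of the open set Omega: all its iterated
   partial derivatives exist in Omega and extend continuously to the closure.
   The first conjunct says that the values of u itself on the boundary are
   those of the continuous extension. Values outside the closure are junk. *)
Definition smooth_closure N (Omega : set 'rV[R]_N) (u : 'rV[R]_N -> R) : Prop :=
  {within closure Omega, continuous u} /\
  forall s : seq 'I_N,
    (forall i x, Omega x -> derivable (partials s u) x (base i)) /\
    exists g : 'rV[R]_N -> R, {within closure Omega, continuous g} /\
      forall x, Omega x -> g x = partials s u x.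

Definition dirichlet_solution N (f : R -> R) (u : 'rV[R]_N -> R) : Prop :=
  (forall x, unit_ball x -> - laplacian u x = f (u x)) /\
  (forall x, unit_sphere x -> u x = 0).

(* The indicator discards the junk values of u outside the ball; for p = +oo
   this is harmless since |u| >= 0. *)
Definition ball_Lnorm N (p : \bar R) (u : 'rV[R]_N -> R) : \bar R :=
  Lnorm (lebesgue_rV N) p (fun x => (u x * \1_(@unit_ball N) x)%:E).

End calculus.

Section morse_index.
Context {R : realType} (N : nat).
Implicit Types (phi u : 'rV[R]_N -> R) (f : R -> R) (X : set ('rV[R]_N -> R)).

Definition C1 phi : Prop :=
  continuous phi /\
  forall i, (forall x, derivable phi x (base i)) /\ continuous (partial i phi).

Definition radial phi : Prop := forall x y, enorm x = enorm y -> phi x = phi y.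

(* Functions with compact support in the ball are identified with their
   extensions by zero. *)
Definition C1_0rad : set ('rV[R]_N -> R) := [set phi |
  [/\ C1 phi, radial phi, compact (closure [set x | phi x != 0]) &
      closure [set x | phi x != 0] `<=` @unit_ball R N]].

Definition lincomb k (b : 'I_k -> 'rV[R]_N -> R) (c : 'I_k -> R) :
  'rV[R]_N -> R := fun x => \sum_i c i * b i x.

(* X is a linear subspace of dimension k: it is spanned by k linearly
   independent functions. *)
Definition subspace_of_dim X (k : nat) : Prop :=
  exists b : 'I_k -> 'rV[R]_N -> R,
    (forall c, lincomb b c = cst 0 -> forall i, c i = 0) /\
    X = range (lincomb b).

Definition morse_form f u phi : \bar R :=
  \int[lebesgue_rV N]_(x in @unit_ball R N)
    (enorm (grad phi x) ^+ 2 - derive1 f (u x) * phi x ^+ 2)%:E.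

Definition morse_negative f u X : Prop :=
  X `<=` C1_0rad /\
  forall phi, X phi -> phi <> cst 0 -> (morse_form f u phi < 0)%E.

Definition radial_morse_index f u (k : nat) : Prop :=
  (exists X, subspace_of_dim X k /\ morse_negative f u X) /\
  (forall m X, subspace_of_dim X m -> morse_negative f u X -> (m <= k)%N).

End morse_index.

(* Main.v *)
(** Take the Aubin-Talenti bubble [w = (1 + L |x|^2)^(1 - N/2)], which solves
    [-Lap w = N (N - 2) L w^((N + 2)/(N - 2))], subtract its value on the unit
    sphere, and let [L] tend to infinity.  The difference is nonnegative on the
    ball, so only the values of the power on [[c, 1]], [c > 0], matter, and it
    is flattened smoothly below [c].

    Morse index: the linearized potential is [V = N (N + 2) L / (1 + L |x|^2)^2]
    and the dilation generator [Z = (1 - L |x|^2) (1 + L |x|^2)^(-N/2)] solves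
    [-Lap Z = V Z].  In a radial space of dimension 2 some nonzero function
    vanishes on the sphere [L |x|^2 = 1] where [Z = 0]; Picone's identity with
    [Z] shows that the quadratic form is nonnegative there.  Conversely the
    [N]-th power of the positive part of [4 - L |x|^2] is a subsolution, hence a
    negative direction.

    Norms: [w >= 2^(1 - N/2)] on a ball of radius [L^(-1/2)] gives
    [||u||_p >= C L^(-N/(2p))].  For [b < N], [b <= q (N - 2)], the bound
    [w^q <= (1 + L |x|^2)^(-b/2) <= prod_i (1 + L x_i^2)^(-b/(2N))] and Tonelli
    give [||u||_q <= C L^(-b/(2q))]; the hypotheses on [p] and [q] allow
    [b > q N / p]. *)
Require Import Defs.
From mathcomp Require Import all_boot all_order all_algebra.
From mathcomp Require Import all_classical all_reals all_analysis.
From mathcomp Require Import measurable_realfun ess_sup_inf ring lra.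
Import Order.TTheory GRing.Theory Num.Theory.
Import numFieldNormedType.Exports.
Local Open Scope classical_set_scope.
Local Open Scope ring_scope.
Set Implicit Arguments.
Unset Strict Implicit.
Unset Printing Implicit Defensive.

(** * Rules for derivatives along a direction *)

Section directional_derivative_rules.
Context {R : realType} {V : normedModType R}.
Implicit Types (f g : V -> R) (x v : V).

Lemma is_derive_add f g x v (a b : R) :
  is_derive x v f a -> is_derive x v g b ->
  is_derive x v (fun y => f y + g y) (a + b).
Proof. exact: is_deriveD. Qed.

Lemma is_derive_sub f g x v (a b : R) :
  is_derive x v f a -> is_derive x v g b ->
  is_derive x v (fun y => f y - g y) (a - b).
Proof. exact: is_deriveB. Qed.

Lemma is_derive_mul f g x v (a b : R) :
  is_derive x v f a -> is_derive x v g b ->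
  is_derive x v (fun y => f y * g y) (f x * b + g x * a).
Proof. exact: is_deriveM. Qed.

Lemma is_derive_scale k f x v (a : R) :
  is_derive x v f a -> is_derive x v (fun y => k * f y) (k * a).
Proof. exact: is_deriveZ. Qed.

Lemma is_derive_exp f n x v (a : R) :
  is_derive x v f a ->
  is_derive x v (fun y => f y ^+ n) (n%:R * f x ^+ n.-1 * a).
Proof.
move=> fa; have := is_deriveX n fa.
by rewrite (_ : f ^+ n = fun y => f y ^+ n)//; apply/funext => y; rewrite exprfctE.
Qed.

Lemma is_derive_bigsum n (f : 'I_n -> V -> R) x v (a : 'I_n -> R) :
  (forall i, is_derive x v (f i) (a i)) ->
  is_derive x v (fun y => \sum_i f i y) (\sum_i a i).
Proof.
move=> fa; have := is_derive_sum fa.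
rewrite (_ : \sum_i f i = fun y => \sum_i f i y)//.
by apply/funext => y; rewrite fct_sumE.
Qed.

(** The two difference quotients are the same function of [h]; this transfers one-variable rules,
    such as the chain rule below, to directional derivatives. *)
Lemma is_derive_line (f : V -> R) x v (a : R) :
  is_derive (0 : R) 1 (fun h : R => f (h *: v + x)) a <-> is_derive x v f a.
Proof.
have dE : 'D_1 (fun h : R => f (h *: v + x)) 0 = 'D_v f x.
  rewrite /derive; set g1 := fun h => h^-1 *: _; set g2 := fun h => h^-1 *: _.
  suff -> : g1 = g2 by [].
  by apply/funext => h; rewrite /g1 /g2 /= addr0 scale0r add0r [_%:A]mulr1.
split=> -[dfx <-]; split; rewrite ?dE//.
  exact: (derivable1P _ _ _).2.
exact: (derivable1P _ _ _).1.
Qed.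

Lemma is_derive_chain (h : R -> R) f x v (a b : R) :
  is_derive (f x) 1 h b -> is_derive x v f a ->
  is_derive x v (fun y => h (f y)) (b * a).
Proof.
move=> hb /is_derive_line fa; apply/is_derive_line.
by apply: (@is_derive1_comp _ h _ 0 b a _ fa); rewrite scale0r add0r.
Qed.

Lemma is_derive_val f x v (a : R) : is_derive x v f a -> 'D_v f x = a.
Proof. by case. Qed.

End directional_derivative_rules.

(** * Smoothness and monotonicity of functions of one real variable *)

Section real_functions.
Context {R : realType}.
Implicit Types (f : R -> R) (t : R).

Lemma is_derive1_val f t a : is_derive t 1 f a -> derive1 f t = a.
Proof. by move=> [_ <-]; rewrite derive1E. Qed.

Lemma is_derive1_continuous f t a : is_derive t 1 f a -> {for t, continuous f}.
Proof. by case=> /derivable1_diffP/differentiable_continuous. Qed.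

(** By induction every iterated derivative stays in the class [P]. A class stable under derivation
    thus replaces explicit formulas for higher derivatives. *)
Lemma smooth_closed (P : (R -> R) -> Prop) f :
  (forall g, P g -> exists2 dg, P dg & forall t, is_derive t 1 g (dg t)) ->
  P f -> smooth f.
Proof.
move=> Pd Pf k; have : P (derive1n k f).
  elim: k => //= k /Pd[dg Pdg gdg].
  rewrite (_ : derive1 _ = dg)//; apply/funext => t; exact: is_derive1_val.
by move=> /Pd[dg _ gdg] t; have [] := gdg t.
Qed.

Lemma ge0_derive_homo f (df : R -> R) :
  (forall t, is_derive t 1 f (df t)) -> (forall t, 0 <= df t) ->
  {homo f : s t / s <= t}.
Proof.
move=> fdf df0 s t st.
apply: (@ger0_derive1_ndecr _ f s t) => //.
- by move=> x _; rewrite (is_derive1_val (fdf x)); exact: df0.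
- apply: continuous_subspaceT => x.
  exact: is_derive1_continuous (fdf x).
Qed.

End real_functions.

(** * Flat functions, vanishing to infinite order at 0 *)

Section flat_function.
Context {R : realType} (M : R).
Hypothesis M0 : 0 < M.

(** The power [t ^- m] makes the family stable under derivation: differentiating [flat m] produces
    only [flat m.+1] and [flat m.+2]. *)
Definition flat (m : nat) (t : R) : R :=
  if t < 0 then t ^- m * expR (M / t) else 0.

(** For [t < 0] put [z = M / |t|]: the exponential series gives [e^z >= z^(m+1) / (m+1)!], and
    [flat m t] has absolute value [|t|^(-m) e^(-z)]. *)
Lemma flat_bound m t : `|flat m t| <= m.+1`!%:R / M ^+ m.+1 * `|t|.
Proof.
rewrite /flat; case: ltP => [t0|_]; last first.
  by rewrite normr0 !mulr_ge0// ?invr_ge0 ?exprn_ge0 ?ler0n ?ltW.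
have nt : 0 < - t by rewrite oppr_gt0.
have ntE : `|t| = - t by rewrite ltr0_norm.
rewrite normrM normfV normrX ntE (ger0_norm (expR_ge0 _)).
have -> : M / t = - (M / - t) by rewrite invrN mulrN opprK.
rewrite expRN.
have z0 : 0 < M / - t by rewrite divr_gt0.
have H : (M / - t) ^+ m.+1 / m.+1`!%:R <= expR (M / - t).
  apply: le_trans (expR_ge1Dxn m (ltW z0)); rewrite lerDr//.
have P0 : 0 < (M / - t) ^+ m.+1 / m.+1`!%:R.
  by rewrite divr_gt0// ?exprn_gt0// ltr0n fact_gt0.
have : (expR (M / - t))^-1 <= ((M / - t) ^+ m.+1 / m.+1`!%:R)^-1.
  by rewrite lef_pV2// posrE expR_gt0.
move=> /(ler_wpM2l (_ : 0 <= (- t) ^- m)) => /(_ _)/le_trans; apply.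
  by rewrite invr_ge0 exprn_ge0// ltW.
rewrite le_eqVlt; apply/orP; left; apply/eqP.
have nt0 : - t != 0 by rewrite gt_eqF.
have M0' : M != 0 by rewrite gt_eqF.
have Mm0 : M ^+ m != 0 by rewrite expf_neq0.
have f0 : m.+1`!%:R != 0 :> R by rewrite pnatr_eq0 -lt0n fact_gt0.
move: (- t) nt0 => s s0; have sm0 : s ^+ m != 0 by rewrite expf_neq0.
by rewrite expr_div_n !exprS; field; rewrite f0 M0' Mm0 sm0 s0.
Qed.

Lemma flat_quotient m t : t != 0 -> t^-1 * flat m t = flat m.+1 t.
Proof.
move=> t0; rewrite /flat; case: ifP => _; last by rewrite mulr0.
by rewrite mulrA exprS invfM.
Qed.

Lemma is_derive_flat m (t : R) :
  is_derive t (1 : R) (flat m) (- m%:R * flat m.+1 t - M * flat m.+2 t).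
Proof.
have [t0|t0|->] := ltgtP t 0.
- apply: (@near_eq_is_derive R _ _ (fun s : R => s ^- m * expR (M / s)) (flat m)).
    have : \forall s \near t, s < 0 by exact: lt_nbhsl.
    by apply: filterS => s s0; rewrite /flat s0.
  have tn0 : t != 0 by rewrite lt_eqF.
  have dinv : is_derive t 1 (fun s : R => s^-1) (- t ^- 2).
    apply: DeriveDef; first exact: derivableV.
    by rewrite deriveV// derive_id [_ *: _]mulr1.
  have dX : is_derive t 1 (fun s : R => s^-1 ^+ m)
      (m%:R * t^-1 ^+ m.-1 * - t ^- 2).
    exact: is_derive_exp.
  have dE : is_derive t 1 (fun s => expR (M * s^-1))
      (expR (M * t^-1) * (M * - t ^- 2)).
    apply: is_derive_chain; exact: is_derive_scale.
  have := is_derive_mul dX dE.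
  rewrite (_ : (fun y => _) = (fun s => s ^- m * expR (M / s))); last first.
    by apply/funext => s; rewrite exprVn.
  move=> /is_derive_eq; apply.
  rewrite /flat t0 !exprVn; case: m {dX} => [|m].
    by rewrite !mul0r expr0 invr1 expr2; field.
  rewrite /= (exprS t m.+2) (exprS t m.+1) (exprS t m).
  have tm0 : t ^+ m != 0 by rewrite expf_neq0.
  by rewrite expr2; field; rewrite tm0 tn0.
- apply: (@near_eq_is_derive R _ _ (cst 0) (flat m)).
    have : \forall s \near t, 0 < s by exact: lt_nbhsr.
    by apply: filterS => s s0; rewrite /flat ltNge ltW.
  by rewrite /flat !ltNge ltW//= !mulr0 subr0; exact: is_derive_cst.
- rewrite /flat ltxx !mulr0 subr0.
  suff H : (fun h : R => h^-1 *: ((flat m \o shift 0) (h *: 1) - flat m 0))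
      @ 0^' --> (0 : R).
    by apply: DeriveDef; [apply/cvg_ex; exists 0 | exact: cvg_lim H].
  apply/cvgrPdist_le => /= e e0.
  (* The difference quotient of [flat m] at 0 is [flat m.+1 h], which [flat_bound] controls by
     [C |h|]; hence the shift of the index in [C]. *)
  pose C := m.+2`!%:R / M ^+ m.+2 : R.
  have C0 : 0 < C by rewrite divr_gt0// ?exprn_gt0// ltr0n fact_gt0.
  near=> h.
  have h0 : h != 0 by near: h; exact: nbhs_dnbhs_neq.
  rewrite {2}/flat ltxx subr0 addr0 [_%:A]mulr1 [_ *: _]flat_quotient//.
  rewrite sub0r normrN (le_trans (flat_bound _ _))// -/C.
  rewrite mulrC -ler_pdivlMr//.
  near: h; apply: dnbhs0_le; exact: divr_gt0.
Unshelve. all: by end_near.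
Qed.

Lemma flat_ge0 t : 0 <= t -> forall m, flat m t = 0.
Proof. by move=> t0 m; rewrite /flat ltNge t0. Qed.

End flat_function.

(** * Smooth positive truncation of an affine function, and its powers *)

Section smooth_truncation.
Context {R : realType} (c : R).
Hypothesis c0 : 0 < c.
Let M0 : 0 < c / 2. Proof. by rewrite divr_gt0. Qed.
Local Notation flat := (flat (c / 2)).

(* A positive nondecreasing smooth function equal to [c + t] for [0 <= t]:
   for [t < 0] it is [c + t - t e^(c / (2 t))], and [1 + z <= e^z] with
   [z = c / (2 t)] gives both [trunc t >= c / 2] and [trunc' t >= 0]. *)
Definition trunc (t : R) : R := c + t - t * flat 0 t.

Definition dtrunc (t : R) : R := 1 - flat 0 t + c / 2 * t * flat 2 t.

Lemma trunc_ge0E t : 0 <= t -> trunc t = c + t.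
Proof. by move=> t0; rewrite /trunc flat_ge0// mulr0 subr0. Qed.

Lemma trunc_gt0 t : 0 < trunc t.
Proof.
have [t0|t0] := leP 0 t; first by rewrite trunc_ge0E// ltr_wpDr.
rewrite /trunc /flat t0 expr0 invr1 mul1r.
have := expR_ge1Dx (c / 2 / t); set e := expR _ => ez.
have : t * e <= t * (1 + c / 2 / t) by rewrite ler_nM2l.
rewrite mulrDr mulr1 mulrCA mulfV ?lt_eqF// mulr1.
by move: c0; lra.
Qed.

Lemma is_derive_trunc (t : R) : is_derive t 1 trunc (dtrunc t).
Proof.
have dF : is_derive t 1 (fun s => s * flat 0 s) (t * _ + flat 0 t * 1) :=
  is_derive_mul (is_derive_id t (1 : R)) (is_derive_flat M0 0 t).
have dA : is_derive t 1 (fun s => c + s) (0 + 1) :=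
  is_derive_add (is_derive_cst c t (1 : R)) (is_derive_id t 1).
apply: is_derive_eq (is_derive_sub dA dF) _.
by rewrite /dtrunc mulr0n oppr0; ring.
Qed.

Lemma dtrunc_ge0 t : 0 <= dtrunc t.
Proof.
rewrite /dtrunc /flat; case: ltP => t0; last by rewrite mulr0 subr0 addr0.
have tn0 : t != 0 by rewrite lt_eqF.
rewrite expr0 invr1 mul1r (_ : _ + _ = 1 - expR (c / 2 / t) * (1 - c / 2 / t)).
  set z := c / 2 / t; rewrite subr_ge0.
  have := expR_ge1Dx (- z); rewrite expRN => zE.
  by rewrite -ler_pdivlMl ?expR_gt0// mulr1.
by field.
Qed.

(** The class fed to [smooth_closed]. It is stable under derivation because [dtrunc] is a polynomial
    in [t] and flat functions, and the derivative of a power of [trunc] is a lower power times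
    [dtrunc]. *)
Inductive trunc_algebra : (R -> R) -> Prop :=
| trunc_cst a : trunc_algebra (cst a)
| trunc_id : trunc_algebra id
| trunc_flat m : trunc_algebra (flat m)
| trunc_pow a : trunc_algebra (fun t => trunc t `^ a)
| trunc_add f g : trunc_algebra f -> trunc_algebra g ->
    trunc_algebra (fun t => f t + g t)
| trunc_mul f g : trunc_algebra f -> trunc_algebra g ->
    trunc_algebra (fun t => f t * g t).

Lemma is_derive_trunc_pow a (t : R) :
  is_derive t 1 (fun s => trunc s `^ a) (a * trunc t `^ (a - 1) * dtrunc t).
Proof.
apply: (@is_derive_chain _ _ (fun y => y `^ a)); last exact: is_derive_trunc.
exact/is_derive1_powR/trunc_gt0.
Qed.

Lemma trunc_algebra_derive f : trunc_algebra f ->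
  exists2 df, trunc_algebra df & forall t : R, is_derive t 1 f (df t).
Proof.
elim=> {f} [a||m|a|f g Af [df Adf fE] Ag [dg Adg gE]
  |f g Af [df Adf fE] Ag [dg Adg gE]].
- by exists (cst 0); [exact: trunc_cst|move=> t; exact: is_derive_cst].
- by exists (cst 1); [exact: trunc_cst|move=> t; exact: is_derive_id].
- exists (fun t => - m%:R * flat m.+1 t + (- (c / 2)) * flat m.+2 t).
    apply: trunc_add; apply: (trunc_mul (trunc_cst _)); exact: trunc_flat.
  by move=> t; rewrite (mulNr (c / 2)); exact: (is_derive_flat M0).
- exists (fun t => a * trunc t `^ (a - 1) *
    ((1 + (- 1) * flat 0 t) + c / 2 * t * flat 2 t)).
    apply: trunc_mul.
      by apply: (trunc_mul (trunc_cst _)); exact: trunc_pow.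
    apply: trunc_add.
      apply: (trunc_add (trunc_cst _)); apply: (trunc_mul (trunc_cst _)).
      exact: trunc_flat.
    apply: trunc_mul; last exact: trunc_flat.
    exact: (trunc_mul (trunc_cst _) trunc_id).
  move=> t; rewrite mulN1r; exact: is_derive_trunc_pow.
- exists (fun t => df t + dg t); first exact: trunc_add.
  by move=> t; exact: is_derive_add.
- exists (fun t => f t * dg t + g t * df t).
    by apply: trunc_add; exact: trunc_mul.
  by move=> t; exact: is_derive_mul.
Qed.

Lemma smooth_trunc_pow k a : smooth (fun t => k * trunc t `^ a).
Proof.
apply: (smooth_closed trunc_algebra_derive).
exact: trunc_mul (trunc_cst k) (trunc_pow a).
Qed.

Lemma trunc_pow_homo k a : 0 <= k -> 0 <= a ->
  {homo (fun t => k * trunc t `^ a) : s t / s <= t}.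
Proof.
move=> k0 a0; apply: (@ge0_derive_homo _ _
    (fun t => k * (a * trunc t `^ (a - 1) * dtrunc t))) => t.
  by apply: is_derive_scale; exact: is_derive_trunc_pow.
by rewrite !mulr_ge0 ?powR_ge0 ?dtrunc_ge0.
Qed.

End smooth_truncation.

(** * Derivatives of functions of the squared Euclidean norm *)

Section euclidean_calculus.
Context {R : realType} (N : nat).
Implicit Types (x : 'rV[R]_N) (i j : 'I_N).

Definition sqnorm x : R := \sum_i x ord0 i ^+ 2.

Lemma sqnorm_ge0 x : 0 <= sqnorm x.
Proof. by apply: sumr_ge0 => i _; exact: sqr_ge0. Qed.

Lemma sqr_coord_le_sqnorm x i : x ord0 i ^+ 2 <= sqnorm x.
Proof.
by rewrite /sqnorm (bigD1 i)//= lerDl; apply: sumr_ge0 => j _; exact: sqr_ge0.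
Qed.

Lemma sqnormE x : enorm x ^+ 2 = sqnorm x.
Proof. by rewrite sqr_sqrtr// sqnorm_ge0. Qed.

Lemma unit_ballE x : unit_ball x <-> sqnorm x < 1.
Proof.
rewrite /unit_ball /mkset -[in X in _ <-> X]sqnormE; have e0 : 0 <= enorm x := sqrtr_ge0 _.
by rewrite expr_lt1.
Qed.

Lemma unit_sphereE x : unit_sphere x -> sqnorm x = 1.
Proof. by rewrite -sqnormE => ->; rewrite expr1n. Qed.

Lemma is_derive_coord x i j :
  is_derive x (base i) (fun y : 'rV[R]_N => y ord0 j) (i == j)%:R.
Proof.
apply/is_derive_line.
rewrite (_ : (fun h : R => _) = fun h => (i == j)%:R * h + x ord0 j); last first.
  by apply/funext => h; rewrite !mxE eqxx/= (eq_sym j) mulrC.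
have dh : is_derive (0 : R) (1 : R) (fun h : R => (i == j)%:R * h) ((i == j)%:R * 1).
  exact: is_derive_scale.
by apply: is_derive_eq (is_derive_add dh (is_derive_cst _ _ _)) _; rewrite mulr1 addr0.
Qed.

Lemma is_derive_sqnorm x i : is_derive x (base i) sqnorm (2 * x ord0 i).
Proof.
apply: is_derive_eq (is_derive_bigsum (fun j => is_derive_exp 2 (is_derive_coord x i j))) _.
rewrite (bigD1 i)//= eqxx big1 ?addr0 ?mulr1// => j ji.
by rewrite eq_sym (negbTE ji) mulr0.
Qed.

Lemma continuous_coord j : continuous (fun x : 'rV[R]_N => x ord0 j).
Proof. exact: coord_continuous. Qed.

Lemma continuous_bigsum (T : topologicalType) n (f : 'I_n -> T -> R) :
  (forall k, continuous (f k)) -> continuous (fun t => \sum_k f k t).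
Proof.
move=> cf t; elim: (index_enum _) => [|k s IHs].
  under eq_fun do rewrite big_nil; exact: cst_continuous.
under eq_fun do rewrite big_cons; exact: continuousD (cf k t) IHs.
Qed.

Lemma continuous_sqnorm : continuous sqnorm.
Proof.
apply: continuous_bigsum => j x.
by under eq_fun do rewrite expr2; apply: continuousM; exact: continuous_coord.
Qed.

(** * Powers of [1 + L |x|^2]: smoothness and Laplacian *)

Section bubble.
Variable L : R.
Hypothesis L0 : 0 < L.

Definition quad x : R := 1 + L * sqnorm x.

Lemma quad_ge1 x : 1 <= quad x.
Proof. by rewrite lerDl mulr_ge0 ?sqnorm_ge0// ltW. Qed.

Lemma quad_gt0 x : 0 < quad x.
Proof. exact: lt_le_trans (quad_ge1 x). Qed.

Lemma is_derive_quad x i : is_derive x (base i) quad (L * (2 * x ord0 i)).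
Proof.
have := is_derive_add (is_derive_cst (1 : R) x (base i))
  (is_derive_scale L (is_derive_sqnorm x i)).
by rewrite add0r.
Qed.

Lemma continuous_quad : continuous quad.
Proof.
move=> x; rewrite (_ : quad = cst 1 + cst L * sqnorm)//.
apply: continuousD; first exact: cst_continuous.
by apply: continuousM; [exact: cst_continuous|exact: continuous_sqnorm].
Qed.

Lemma is_derive_quad_pow a x i :
  is_derive x (base i) (fun y => quad y `^ a)
    (a * quad x `^ (a - 1) * (L * (2 * x ord0 i))).
Proof.
apply: (@is_derive_chain _ _ (fun y => y `^ a)); last exact: is_derive_quad.
exact/is_derive1_powR/quad_gt0.
Qed.

Lemma continuous_quad_pow a : continuous (fun x => quad x `^ a).
Proof.
move=> x; apply: (continuous_comp (g := fun y => y `^ a)).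
  exact: continuous_quad.
exact: is_derive1_continuous (is_derive1_powR a (quad_gt0 x)).
Qed.

(** Stable under partial derivatives and made of functions continuous on the whole space, so each
    iterated partial derivative is its own continuous extension to a closure. *)
Inductive bubble_algebra : ('rV[R]_N -> R) -> Prop :=
| bubble_cst a : bubble_algebra (cst a)
| bubble_coord j : bubble_algebra (fun x => x ord0 j)
| bubble_pow a : bubble_algebra (fun x => quad x `^ a)
| bubble_add f g : bubble_algebra f -> bubble_algebra g ->
    bubble_algebra (fun x => f x + g x)
| bubble_mul f g : bubble_algebra f -> bubble_algebra g ->
    bubble_algebra (fun x => f x * g x).

Lemma bubble_algebra_derive f i : bubble_algebra f ->
  exists2 df, bubble_algebra df & forall x, is_derive x (base i) f (df x).
Proof.
elim=> {f} [a|j|a|f g Af [df Adf fE] Ag [dg Adg gE]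
  |f g Af [df Adf fE] Ag [dg Adg gE]].
- by exists (cst 0); [exact: bubble_cst|move=> x; exact: is_derive_cst].
- exists (cst (i == j)%:R); first exact: bubble_cst.
  by move=> x; exact: is_derive_coord.
- exists (fun x => a * quad x `^ (a - 1) * (L * (2 * x ord0 i))).
    apply: bubble_mul.
      by apply: (bubble_mul (bubble_cst _)); exact: bubble_pow.
    do 2 apply: (bubble_mul (bubble_cst _)); exact: bubble_coord.
  by move=> x; exact: is_derive_quad_pow.
- exists (fun x => df x + dg x); first exact: bubble_add.
  by move=> x; exact: is_derive_add.
- exists (fun x => f x * dg x + g x * df x).
    by apply: bubble_add; exact: bubble_mul.
  by move=> x; exact: is_derive_mul.
Qed.

Lemma bubble_algebra_partial f i : bubble_algebra f -> bubble_algebra (partial i f).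
Proof.
move=> /(bubble_algebra_derive i)[df Adf fE].
rewrite (_ : partial i f = df)//; apply/funext => x.
exact: is_derive_val (fE x).
Qed.

Lemma bubble_algebra_continuous f : bubble_algebra f -> continuous f.
Proof.
elim=> {f} [a|j|a|f g _ cf _ cg|f g _ cf _ cg] x.
- exact: cst_continuous.
- exact: continuous_coord.
- exact: continuous_quad_pow.
- exact: continuousD (cf x) (cg x).
- exact: continuousM (cf x) (cg x).
Qed.

Lemma bubble_algebra_smooth (Omega : set 'rV[R]_N) f :
  bubble_algebra f -> smooth_closure Omega f.
Proof.
move=> Af; split.
  exact/continuous_subspaceT/bubble_algebra_continuous.
move=> s; have As : bubble_algebra (partials s f).
  by elim: s => //= i s; exact: bubble_algebra_partial.
split=> [i x _|]; first by have [df _ /(_ x)[]] := bubble_algebra_derive i As.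
exists (partials s f); split=> //.
exact/continuous_subspaceT/bubble_algebra_continuous.
Qed.

(** Substituting [L |x|^2 = quad x - 1] leaves only powers of [quad]. At [a = 1 - N/2] the factor
    [N + 2 (a - 1)] vanishes, and the second term becomes [- N (N - 2) L quad^(a - 2)]: the bubble
    equation. *)
Lemma laplacian_quad_pow a c x :
  laplacian (fun y => quad y `^ a - c) x =
  2 * a * L * (N%:R + 2 * (a - 1)) * quad x `^ (a - 1)
    - 4 * a * (a - 1) * L * quad x `^ (a - 2).
Proof.
have partialE i : partial i (fun y => quad y `^ a - c) =
    fun x => a * quad x `^ (a - 1) * (L * (2 * x ord0 i)).
  apply/funext => y; apply: is_derive_val.
  apply: is_derive_eq (is_derive_sub (is_derive_quad_pow a y i)
    (is_derive_cst c _ _)) _.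
  by rewrite subr0.
have partial2E i : partial i (partial i (fun y => quad y `^ a - c)) x =
    2 * a * L * quad x `^ (a - 1) +
    4 * a * (a - 1) * L ^+ 2 * quad x `^ (a - 2) * x ord0 i ^+ 2.
  rewrite partialE; apply: is_derive_val.
  apply: is_derive_eq (is_derive_mul
    (is_derive_scale a (is_derive_quad_pow (a - 1) x i))
    (is_derive_scale L (is_derive_scale 2 (is_derive_coord x i i)))) _.
  rewrite eqxx /= (_ : a - 1 - 1 = a - 2); last by ring.
  by ring.
rewrite /laplacian (eq_bigr _ (fun i _ => partial2E i)) big_split/=.
rewrite sumr_const card_ord -mulr_sumr -/(sqnorm x).
have LsE : L * sqnorm x = quad x - 1 by rewrite /quad addrC addKr.
have -> : quad x `^ (a - 1) = quad x `^ (a - 2) * quad x.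
  rewrite (_ : a - 1 = a - 2 + 1); last by ring.
  by rewrite powRD ?powRr1 ?(gt_eqF (quad_gt0 x)) ?implybT// ltW ?quad_gt0.
transitivity (2 * a * L * (quad x `^ (a - 2) * quad x) * N%:R +
    4 * a * (a - 1) * L * quad x `^ (a - 2) * (L * sqnorm x)).
  by rewrite -[_ *+ N]mulr_natr; ring.
by rewrite LsE; ring.
Qed.

End bubble.
End euclidean_calculus.

(** * Open sets and continuous functions are measurable for the coordinate sigma-algebra *)

Section measurability_of_continuous_functions.
Context {R : realType} (n : nat).

Let box (qk : {ffun 'I_n -> rat} * nat) : set 'rV[R]_n :=
  [set x | forall i : 'I_n, `|x ord0 i - ratr (qk.1 i)| < qk.2.+1%:R^-1].

Let measurable_box qk : measurable (box qk).
Proof.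
rewrite (_ : box qk = \bigcap_(i in [set: 'I_n])
    ((fun x : 'rV[R]_n => x ord0 i : measurableTypeR R) @^-1`
      ball (ratr (qk.1 i) : R) qk.2.+1%:R^-1)); last first.
  apply/seteqP; split=> x bx i; first by move=> _; rewrite /= /ball/= distrC; exact: bx.
  by have := bx i I; rewrite /= /ball/= distrC.
apply: fin_bigcap_measurable => // i _.
rewrite -[X in measurable X]setTI; apply: measurable_coord => //.
exact: measurable_ball.
Qed.

(** The boxes with rational centre and radius [1 / (k + 1)] are countably many, and [U] is the union
    of those it contains; [unpickle] enumerates them. *)
Lemma open_measurable_rV (U : set 'rV[R]_n) : open U -> measurable U.
Proof.
move=> oU.
pose F m := if unpickle m is Some qk then
  (if pselect (box qk `<=` U) then box qk else set0) else set0.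
rewrite (_ : U = \bigcup_m F m).
  apply: bigcup_measurable => m _; rewrite /F.
  by case: unpickle => [qk|//]; case: pselect => ? /=; [exact: measurable_box|].
apply/seteqP; split=> [x Ux|x [m _]]; last first.
  rewrite /F; case: unpickle => [qk|//].
  by case: pselect => [bU|//] /= /bU.
have [e /= e0 xeU] : nbhs_ball x U by apply/nbhs_ballP; exact: open_nbhs_nbhs.
(* Two points of a box of radius [1 / (k + 1)] are at sup distance less than twice that radius,
   whence the factor 2. *)
have [k _ ke] : exists2 k : nat, True & 2 * k.+1%:R^-1 < e.
  have e20 : 0 < e / 2 by rewrite divr_gt0.
  have := near_infty_natSinv_lt (PosNum e20) => -[k _ /(_ k (leqnn k))/= kE].
  by exists k => //; rewrite mulrC -ltr_pdivlMr.
have qP i : exists q : rat, `|x ord0 i - ratr q| < k.+1%:R^-1.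
  have k0 : 0 < k.+1%:R^-1 :> R by rewrite invr_gt0.
  have /rat_in_itvoo[q] : x ord0 i < x ord0 i + k.+1%:R^-1 by rewrite ltrDl.
  rewrite in_itv/= => /andP[xq qx]; exists q.
  by rewrite ltr0_norm ?subr_lt0// opprB ltrBlDl.
have [q qE] := choice qP.
have bq : box ([ffun i => q i], k) x by move=> i; rewrite /= ffunE.
exists (pickle ([ffun i => q i], k)) => //.
rewrite /F pickleK; case: pselect => // -[] y yb; apply: xeU; split=> // i j.
rewrite (ord1 i) /ball/=; apply: le_lt_trans ke.
rewrite (le_trans (ler_distD (ratr (q j)) _ _))//.
rewrite mulr_natl mulr2n lerD//; first exact/ltW/qE.
by rewrite distrC; have := yb j; rewrite /= ffunE => /ltW.
Qed.

Lemma continuous_measurable_rV (f : 'rV[R]_n -> R) :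
  continuous f -> measurable_fun setT f.
Proof.
move=> /continuousP cf; apply: (measurability _ (RGenOpens.measurableE R)).
move=> _ [_ [a [b ->] <-]]; rewrite setTI; apply: open_measurable_rV.
exact/cf/interval_open.
Qed.

End measurability_of_continuous_functions.

(** * Integrability of functions supported in a cube, and Fubini *)

Section integration_over_cubes.
Context {R : realType}.
Local Open Scope ereal_scope.

Definition cube n (M : R) : set 'rV[R]_n :=
  [set x | forall i, (`|x ord0 i| <= M)%R].

Lemma measurable_cube n M : measurable (@cube n M).
Proof.
rewrite (_ : @cube n M = \bigcap_(i in [set: 'I_n])
    ((fun x : 'rV[R]_n => x ord0 i : measurableTypeR R) @^-1`
      [set` `[- M, M]%R])); last first.
  apply/seteqP; split=> x xM i; first by move=> _; rewrite /= in_itv/= -ler_norml.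
  by have := xM i I; rewrite /= in_itv/= -ler_norml.
apply: fin_bigcap_measurable => // i _.
rewrite -[X in measurable X]setTI; exact: measurable_coord.
Qed.

Lemma lebesgue_cube n M : (0 <= M)%R ->
  lebesgue_rV n (@cube n M) = ((2 * M) ^+ n)%:E.
Proof.
move=> M0; rewrite (_ : @cube n M =
    [set x | forall i, [set` `[- M, M]%R] (x ord0 i)]); last first.
  by apply/seteqP; split=> x xM i; have := xM i; rewrite /= in_itv/= -ler_norml.
rewrite (@lebesgue_rV_box R n (fun=> [set` `[- M, M]%R])) => [|i]; last first.
  exact: measurable_itv.
have -> : lebesgue_measure ([set` `[- M, M]%R] : set (measurableTypeR R))
    = (2 * M)%:E.
  rewrite lebesgue_measure_itv/= lte_fin; case: ltP => H.
    by rewrite -EFinD opprK mulr_natl mulr2n.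
  have -> : M = 0%R by apply/eqP; rewrite eq_le M0 andbT; move: H; lra.
  by rewrite mulr0.
elim: n => [|n IHn]; first by rewrite big_ord0 expr0.
by rewrite big_ord_recl IHn exprS EFinM.
Qed.

Lemma compact_cube n M : compact (@cube n M).
Proof.
have := @rV_compact R n (fun=> [set` `[- M, M]%R]) (fun=> @segment_compact _ _ _).
congr compact; apply/seteqP; split=> x xM i; have := xM i;
  by rewrite /= in_itv/= -ler_norml.
Qed.

Lemma cube_bounded n (g : 'rV[R]_n -> R) M : continuous g ->
  (forall x, ~ cube M x -> g x = 0%R) ->
  exists2 B, (0 <= B)%R & forall x, (`|g x| <= B)%R.
Proof.
move=> cg g0.
have /compact_bounded[B [_ gB]] : compact (g @` cube M).
  apply: continuous_compact; last exact: compact_cube.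
  exact: continuous_subspaceT.
exists (`|B| + 1)%R; first by rewrite addr_ge0.
move=> x; have [xM|/g0->] := pselect (cube M x); last by rewrite normr0 addr_ge0.
by apply: (gB (`|B| + 1)%R); [rewrite ltr_pwDr// ler_norm|exists x].
Qed.

Lemma bounded_cube_integrable n (g : 'rV[R]_n -> R) (M B : R) :
  measurable_fun setT g -> (forall x, `|g x| <= B)%R ->
  (forall x, ~ cube M x -> g x = 0%R) ->
  (lebesgue_rV n).-integrable setT (EFin \o g).
Proof.
move=> mg gB g0.
have B0 : (0 <= B)%R by exact: le_trans (gB 0%R).
(* The dominating function lives on the cube of half-side [|M|], which contains [cube M] and has the
   volume of [lebesgue_cube] whatever the sign of [M]. *)
have iB : (lebesgue_rV n).-integrable setT
    (fun x => B%:E * (\1_(@cube n `|M|) x)%:E).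
  have mC := @measurable_cube n `|M|; apply: integrableZl => //.
  apply/integrableP; split; first exact/measurable_EFinP.
  under eq_integral => x _ do rewrite gee0_abs ?lee_fin//.
  rewrite integral_indic// setIT.
  have /= -> := @lebesgue_cube n `|M|%R (normr_ge0 M).
  exact: ltry.
apply: le_integrable iB => //; first exact/measurable_EFinP.
move=> x _; rewrite -EFinM /= lee_fin indicE.
have [xM|xM] := pselect (cube `|M| x).
  by rewrite mem_set// mulr1 (le_trans (gB x))// ler_norm.
rewrite g0 ?normr0// => xM'; apply: xM => i.
exact: le_trans (xM' i) (ler_norm _).
Qed.

Lemma continuous_cube_integrable n (g : 'rV[R]_n -> R) M : continuous g ->
  (forall x, ~ cube M x -> g x = 0%R) ->
  (lebesgue_rV n).-integrable setT (EFin \o g).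
Proof.
move=> cg g0; have [B _ gB] := cube_bounded cg g0.
apply: bounded_cube_integrable gB g0; exact: continuous_measurable_rV.
Qed.

(** Both orders serve in [integral_partial_support]: the variable of differentiation must lie in the
    inner integral, be it the first coordinate or a later one. *)
Lemma lebesgue_rV_fubini n (g : 'rV[R]_n.+1 -> R) :
  (lebesgue_rV n.+1).-integrable setT (EFin \o g) ->
  \int[lebesgue_rV n.+1]_x (g x)%:E =
    \int[lebesgue_measure]_a \int[lebesgue_rV n]_y (g (cons_rV (a, y)))%:E /\
  \int[lebesgue_rV n.+1]_x (g x)%:E =
    \int[lebesgue_rV n]_y \int[lebesgue_measure]_a (g (cons_rV (a, y)))%:E.
Proof.
move=> ig; have [mg gfin] := integrableP _ _ _ ig.
have mc : measurable_fun setT (EFin \o g \o @cons_rV R n).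
  exact: measurableT_comp mg (@measurable_cons_rV R n).
have ic : (@lebesgue_measure R \x lebesgue_rV n).-integrable setT
    (EFin \o g \o @cons_rV R n).
  apply/integrableP; split=> //.
  move: gfin; rewrite (@ge0_integral_pushforward _ _ _ _ _ _
    (@measurable_cons_rV R n) (@lebesgue_measure R \x lebesgue_rV n))//.
  exact: measurableT_comp.
rewrite (@integral_pushforward _ _ _ _ _ _ (@measurable_cons_rV R n)
  (@lebesgue_measure R \x lebesgue_rV n))//.
split.
  by rewrite preimage_setT -(integral12_prod_meas1 ic).
by rewrite preimage_setT -(integral21_prod_meas1 ic).
Qed.

Lemma ge0_lebesgue_rV_fubini n (g : 'rV[R]_n.+1 -> R) :
  measurable_fun setT g -> (forall x, 0 <= g x)%R ->
  \int[lebesgue_rV n.+1]_x (g x)%:E =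
    \int[lebesgue_measure]_a \int[lebesgue_rV n]_y (g (cons_rV (a, y)))%:E.
Proof.
move=> mg g0.
rewrite (@ge0_integral_pushforward _ _ _ _ _ _ (@measurable_cons_rV R n)
  (@lebesgue_measure R \x lebesgue_rV n))//; last 2 first.
- exact/measurable_EFinP.
- by move=> x _; rewrite lee_fin.
rewrite preimage_setT fubini_tonelli1//.
- apply/measurable_EFinP; exact: measurableT_comp mg (@measurable_cons_rV R n).
- by move=> z; rewrite /= lee_fin.
Qed.

End integration_over_cubes.

(** * Partial derivatives of compactly supported functions integrate to zero *)

Section divergence.
Context {R : realType}.

Lemma cons_rV0 n (a : R) (y : 'rV[R]_n) : cons_rV (a, y) ord0 ord0 = a.
Proof. by rewrite mxE unlift_none. Qed.

Lemma cons_rVS n (a : R) (y : 'rV[R]_n) j :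
  cons_rV (a, y) ord0 (lift ord0 j) = y ord0 j.
Proof. by rewrite mxE liftK. Qed.

Lemma continuous_cons_rVr n (a : R) :
  continuous (fun y : 'rV[R]_n => cons_rV (a, y)).
Proof.
move=> y U /nbhs_ballP[e /= e0 eU]; apply/nbhs_ballP; exists e => // z [_ yz].
apply: eU; split=> // k i; rewrite (ord1 k).
case: (unliftP ord0 i) => [j ->|->]; last by rewrite !cons_rV0; exact: ballxx.
by rewrite !cons_rVS; exact: yz.
Qed.

Lemma continuous_cons_rVl n (y : 'rV[R]_n) :
  continuous (fun a : R => cons_rV (a, y)).
Proof.
move=> a U /nbhs_ballP[e /= e0 eU]; apply/nbhs_ballP; exists e => // b ab.
apply: eU; split=> // k i; rewrite (ord1 k).
case: (unliftP ord0 i) => [j ->|->]; first by rewrite !cons_rVS; exact: ballxx.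
by rewrite !cons_rV0.
Qed.

Lemma cube_cons_rV n (a : R) (y : 'rV[R]_n) M :
  cube M (cons_rV (a, y)) <-> `|a| <= M /\ cube M y.
Proof.
split=> [C|[aM yM] i].
  split=> [|j]; first by have := C ord0; rewrite cons_rV0.
  by have := C (lift ord0 j); rewrite cons_rVS.
by case: (unliftP ord0 i) => [j ->|->]; rewrite ?cons_rVS ?cons_rV0.
Qed.

Lemma is_derive_cons_rVr n (G : 'rV[R]_n.+1 -> R) (a d : R) y j :
  is_derive (cons_rV (a, y)) (base (lift ord0 j)) G d ->
  is_derive y (base j) (fun z => G (cons_rV (a, z))) d.
Proof.
move=> /is_derive_line dG; apply/is_derive_line.
rewrite (_ : (fun h => _) =
  fun h => G (h *: base (lift ord0 j) + cons_rV (a, y)))//.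
apply/funext => h; congr G; apply/rowP => i.
case: (unliftP ord0 i) => [k ->|->].
  rewrite cons_rVS [in RHS]mxE cons_rVS !mxE eqxx/=.
  by rewrite (inj_eq (@lift_inj _ _)).
by rewrite cons_rV0 [in RHS]mxE cons_rV0 !mxE eqxx/= mulr0 add0r.
Qed.

Lemma is_derive_cons_rVl n (G : 'rV[R]_n.+1 -> R) (a d : R) y :
  is_derive (cons_rV (a, y)) (base ord0) G d ->
  is_derive a 1 (fun b => G (cons_rV (b, y))) d.
Proof.
move=> /is_derive_line dG; apply/is_derive_line.
rewrite (_ : (fun h => _) =
  fun h => G (h *: base ord0 + cons_rV (a, y)))//.
apply/funext => h; congr G; apply/rowP => i.
case: (unliftP ord0 i) => [k ->|->].
  by rewrite cons_rVS [in RHS]mxE cons_rVS !mxE eqxx/= mulr0 add0r.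
by rewrite cons_rV0 [in RHS]mxE cons_rV0 !mxE !eqxx.
Qed.

Lemma integral_derive1_support (F f : R -> R) (M : R) :
  (forall a : R, is_derive a 1 F (f a)) -> continuous f ->
  (forall a, M < `|a| -> F a = 0 /\ f a = 0) ->
  (\int[lebesgue_measure]_a (f a)%:E = 0)%E.
Proof.
move=> dF cf F0; pose K : R := `|M| + 1.
have MK : M < K by rewrite (le_lt_trans (ler_norm M))// ltrDl.
have K0 : 0 < K by rewrite ltr_wpDl.
have -> : (\int[lebesgue_measure]_a (f a)%:E =
    \int[lebesgue_measure]_(a in [set` `[- K, K]%R]) (f a)%:E)%E.
  rewrite [RHS]integral_mkcond; apply: eq_integral => a _.
  rewrite patchE; case: ifPn => // /negP aK.
  rewrite (F0 a _).2//; rewrite ltNge; apply/negP => aM; apply: aK.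
  by rewrite inE/= in_itv/= -ler_norml (le_trans aM)// ltW.
rewrite (@continuous_FTC2 _ f F)//.
- have FK a : `|a| = K -> F a = 0 by move=> aK; apply: (F0 a _).1; rewrite aK.
  by rewrite !FK ?subee// ?normrN gtr0_norm.
- by move: K0; lra.
- exact: continuous_subspaceT.
- split=> [x _||]; first by case: (dF x).
  + by apply: cvg_at_right_filter; exact: is_derive1_continuous (dF _).
  + by apply: cvg_at_left_filter; exact: is_derive1_continuous (dF _).
- by move=> x _; exact: is_derive1_val (dF x).
Qed.

(** Induction on the dimension. For the first coordinate the inner integral vanishes by the
    fundamental theorem of calculus; for a later one the induction hypothesis applies to each slice
    at fixed first coordinate. *)
Lemma integral_partial_support n (G g : 'rV[R]_n -> R) (i : 'I_n) (M : R) :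
  (forall x, is_derive x (base i) G (g x)) -> continuous g ->
  (forall x, ~ cube M x -> G x = 0 /\ g x = 0) ->
  (\int[lebesgue_rV n]_x (g x)%:E = 0)%E.
Proof.
elim: n => [|n IHn] in G g i *; first by case: i.
move=> dG cg G0.
have ig : (lebesgue_rV n.+1).-integrable setT (EFin \o g).
  by apply: (@continuous_cube_integrable _ _ _ M) => // x /G0[].
have [E1 E2] := lebesgue_rV_fubini ig.
case: (unliftP ord0 i) dG => [j ->|->] dG.
  rewrite E1; apply: integral0_eq => a _.
  apply: (IHn (fun y => G (cons_rV (a, y))) _ j).
  - by move=> y; apply: is_derive_cons_rVr.
  - move=> y; apply: (continuous_comp (f := fun y => cons_rV (a, y)) (g := g));
      last exact: cg.
    exact: continuous_cons_rVr.
  - by move=> y yM; apply: G0 => /cube_cons_rV[].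
rewrite E2; apply: integral0_eq => y _.
apply: (@integral_derive1_support (fun a => G (cons_rV (a, y))) _ M).
- by move=> a; apply: is_derive_cons_rVl.
- move=> a; apply: (continuous_comp (f := fun a => cons_rV (a, y)) (g := g));
    last exact: cg.
  exact: continuous_cons_rVl.
- move=> a aM; apply: G0 => /cube_cons_rV[].
  by rewrite leNgt aM.
Qed.

End divergence.

(** * Continuity at a point *)

Section pointwise_continuity_rules.
Context {R : realType} {T : topologicalType}.
Implicit Types (f g : T -> R) (x : T).

Lemma continuous_add f g x : {for x, continuous f} -> {for x, continuous g} ->
  {for x, continuous (fun y => f y + g y)}.
Proof. exact: continuousD. Qed.

Lemma continuous_sub f g x : {for x, continuous f} -> {for x, continuous g} ->
  {for x, continuous (fun y => f y - g y)}.
Proof. exact: continuousB. Qed.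

Lemma continuous_mul f g x : {for x, continuous f} -> {for x, continuous g} ->
  {for x, continuous (fun y => f y * g y)}.
Proof. exact: continuousM. Qed.

Lemma continuous_scale k f x : {for x, continuous f} ->
  {for x, continuous (fun y => k * f y)}.
Proof. by apply: continuous_mul; exact: cst_continuous. Qed.

Lemma continuous_pow n f x : {for x, continuous f} ->
  {for x, continuous (fun y => f y ^+ n)}.
Proof.
move=> cf; apply: (continuous_comp (f := f) (g := fun y => y ^+ n)) => //.
exact: exprn_continuous.
Qed.

(** Serves where a quotient has zero denominator but is multiplied by a function vanishing in a
    neighbourhood. *)
Lemma continuous_near_cst f k x : (\near x, f x = k) -> {for x, continuous f}.
Proof.
move=> fk; rewrite /prop_for /continuous_at (nbhs_singleton fk).
apply: cvg_trans (@cvg_cst R k T (nbhs x) _); apply: near_eq_cvg.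
by apply: filterS fk => y ->.
Qed.

End pointwise_continuity_rules.

(** * Integration over the unit ball *)

Section integration_over_the_ball.
Context {R : realType} (N : nat).
Implicit Types (g h : 'rV[R]_N -> R) (x : 'rV[R]_N).
Local Notation ball := (@unit_ball R N).
Local Notation mu := (lebesgue_rV N).

Lemma unit_ball_cube x : ball x -> cube 1 x.
Proof.
move=> /unit_ballE x1 i; rewrite -(@expr_le1 _ 2)// -normrX ger0_norm ?sqr_ge0//.
exact: le_trans (sqr_coord_le_sqnorm _ _) (ltW x1).
Qed.

Lemma open_unit_ball : open ball.
Proof.
rewrite (_ : ball = @sqnorm R N @^-1` [set y | y < 1]); last first.
  by apply/seteqP; split=> x /unit_ballE.
by move: (@continuous_sqnorm R N) => /continuousP; apply; exact: open_lt.
Qed.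

Lemma measurable_unit_ball : measurable ball.
Proof. by apply: open_measurable_rV; exact: open_unit_ball. Qed.

Lemma eq_integral_ball g : (forall x, ~ ball x -> g x = 0) ->
  (\int[mu]_(x in ball) (g x)%:E = \int[mu]_x (g x)%:E)%E.
Proof.
move=> g0; rewrite integral_mkcond; apply: eq_integral => x _.
by rewrite patchE; case: ifPn => // /negP xb; rewrite g0// => bx; apply/xb/mem_set.
Qed.

Lemma continuous_ball_integrable g : continuous g ->
  (forall x, ~ ball x -> g x = 0) -> mu.-integrable setT (EFin \o g).
Proof.
move=> cg g0; apply: (@continuous_cube_integrable _ _ _ 1) => // x xc.
by apply: g0 => /unit_ball_cube.
Qed.

Lemma continuous_ball_bounded g : continuous g ->
  (forall x, ~ ball x -> g x = 0) -> exists2 B, 0 <= B & forall x, `|g x| <= B.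
Proof.
move=> cg g0; apply: (@cube_bounded _ _ _ 1) => // x xc.
by apply: g0 => /unit_ball_cube.
Qed.

Lemma divergence_ball (F dF : 'I_N -> 'rV[R]_N -> R) :
  (forall i x, is_derive x (base i) (F i) (dF i x)) ->
  (forall i, continuous (dF i)) ->
  (forall i x, ~ ball x -> F i x = 0 /\ dF i x = 0) ->
  (\int[mu]_x (\sum_i dF i x)%:E = 0)%E.
Proof.
move=> FdF cdF F0.
under eq_integral do rewrite -sumEFin.
rewrite integral_sum//=; last first.
  move=> i; apply: continuous_ball_integrable => // x /F0 -/(_ i)[] //.
rewrite big1// => i _; apply: (@integral_partial_support _ _ (F i) _ i 1) => //.
by move=> x xc; apply: F0 => /unit_ball_cube.
Qed.

(** The divergence integrates to zero. The error [e] is charged only on the cube [[-1, 1]^N], of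
    volume [2^N], since outside the ball both the divergence and [g] vanish. *)
Lemma integral_divergence_ge (F dF : 'I_N -> 'rV[R]_N -> R) g e :
  (forall i x, is_derive x (base i) (F i) (dF i x)) ->
  (forall i, continuous (dF i)) ->
  (forall i x, ~ ball x -> F i x = 0 /\ dF i x = 0) ->
  continuous g -> (forall x, ~ ball x -> g x = 0) -> 0 <= e ->
  (forall x, \sum_i dF i x - e <= g x) ->
  ((- (e * 2 ^+ N))%:E <= \int[mu]_x (g x)%:E)%E.
Proof.
move=> FdF cdF F0 cg g0 e0 dFg.
have idF : mu.-integrable setT (EFin \o (fun x => \sum_i dF i x)).
  apply: continuous_ball_integrable; first exact: continuous_bigsum.
  by move=> x xb; apply: big1 => i _; exact: (F0 i x xb).2.
have mC := @measurable_cube R N 1.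
have iC : mu.-integrable setT (fun x => (\1_(cube 1) x : R)%:E).
  apply: (@bounded_cube_integrable _ _ _ 1 1).
  - exact: measurable_indic.
  - by move=> x; rewrite indicE; case: (_ \in _); rewrite ?normr1 ?normr0.
  - by move=> x xc; rewrite indicE memNset.
have ie := integrableZl measurableT e iC.
have -> : ((- (e * 2 ^+ N))%:E = \int[mu]_x ((\sum_i dF i x)%:E -
    e%:E * (\1_(@cube R N 1) x)%:E))%E.
  rewrite integralB//= (divergence_ball FdF cdF F0) sub0e integralZl//.
  rewrite integral_indic// setIT.
  have /= -> := @lebesgue_cube R N 1 ler01.
  by rewrite mulr1 -EFinM EFinN.
apply: le_integral => //; first exact: integrableB.
  exact: continuous_ball_integrable.
move=> x _; rewrite /= lee_fin indicE.
have [xc|xc] := pselect (@cube R N 1 x); first by rewrite mem_set// mulr1.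
have xb : ~ ball x by move=> /unit_ball_cube.
rewrite memNset// mulr0 subr0 g0// big1// => i _; exact: (F0 i x xb).2.
Qed.

Lemma integral_gt0_ball h : continuous h -> (forall x, ~ ball x -> h x = 0) ->
  (forall x, 0 <= h x) -> 0 < h 0 -> (0 < \int[mu]_x (h x)%:E)%E.
Proof.
move=> ch hb h0 h00.
have [e /= e0 eh] : nbhs_ball (0 : 'rV[R]_N) [set x | h 0 / 2 < h x].
  apply/nbhs_ballP; have : \forall y \near h 0, h 0 / 2 < y.
    by apply: lt_nbhsr; rewrite ltr_pdivrMr// ltr_pMr// ltr1n.
  exact: ch.
have mC := @measurable_cube R N (e / 2).
have e20 : 0 < e / 2 by rewrite divr_gt0.
apply: (@lt_le_trans _ _ (\int[mu]_x ((h 0 / 2)%:E * (\1_(cube (e / 2)) x)%:E))%E).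
  rewrite ge0_integralZl_EFin//; last 2 first.
  - exact/measurable_EFinP.
  - by rewrite divr_ge0// ltW.
  rewrite integral_indic// setIT.
  have /= -> := @lebesgue_cube R N (e / 2) (ltW e20).
  by rewrite -EFinM lte_fin mulr_gt0 ?divr_gt0// exprn_gt0// mulr_gt0.
have mh : measurable_fun setT (EFin \o h).
  by apply/measurable_EFinP; apply: continuous_measurable_rV.
apply: ge0_le_integral => //.
- by move=> x _; rewrite -EFinM lee_fin mulr_ge0// divr_ge0// ltW.
- by apply/measurable_EFinP; apply: measurable_funM.
move=> x _; rewrite -EFinM lee_fin indicE.
have [xc|xc] := pselect (@cube R N (e / 2) x); last by rewrite memNset// mulr0.
rewrite mem_set// mulr1; apply/ltW/(eh x); split=> // k i.
rewrite (ord1 k) mxE -ball_normE /ball_/= sub0r normrN (le_lt_trans (xc i))//.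
by rewrite ltr_pdivrMr// ltr_pMr// ltr1n.
Qed.

End integration_over_the_ball.

(** * Powers of the positive part *)

Section positive_part_powers.
Context {R : realType}.
Implicit Types (m : nat) (y : R).

Definition pospow m y : R := Num.max y 0 ^+ m.

Lemma pospow_ge0 m y : 0 <= pospow m y.
Proof. by rewrite exprn_ge0// le_max lexx orbT. Qed.

Lemma continuous_pospow m : continuous (pospow m).
Proof.
move=> y.
apply: (@continuous_pow R R m (fun z : R => Num.max z 0) y).
by apply: (@continuous_max _ _ id (cst 0)); [exact: cvg_id|exact: cst_continuous].
Qed.

Lemma pospow_le0 m y : y <= 0 -> pospow m.+1 y = 0.
Proof. by move=> y0; rewrite /pospow max_r// expr0n. Qed.

Lemma is_derive_pospow m y :
  is_derive y (1 : R) (pospow m.+2) (m.+2%:R * pospow m.+1 y).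
Proof.
have [y0|y0|->] := ltgtP y 0.
- rewrite pospow_le0 ?ltW// mulr0.
  apply: (@near_eq_is_derive R _ _ (cst 0) (pospow m.+2)).
  have : \forall z \near y, z < 0 by exact: lt_nbhsl.
  by apply: filterS => z z0; rewrite pospow_le0// ltW.
- apply: (@near_eq_is_derive R _ _ (fun z : R => z ^+ m.+2) (pospow m.+2)).
    have : \forall z \near y, 0 < z by exact: lt_nbhsr.
    by apply: filterS => z z0; rewrite /pospow max_l// ltW.
  have := is_derive_exp m.+2 (is_derive_id y (1 : R)).
  by rewrite mulr1 /pospow max_l// ltW.
- rewrite pospow_le0// mulr0.
  (* At 0 the difference quotient is at most [|h|^(m+1)], hence at most [|h|] once [|h| <= 1]. *)
  have H : (fun h : R => h^-1 *: ((pospow m.+2 \o shift 0) (h *: 1)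
      - pospow m.+2 0)) @ 0^' --> (0 : R).
    apply/cvgrPdist_le => /= e e0; near=> h.
    have h0 : h != 0 by near: h; exact: nbhs_dnbhs_neq.
    rewrite (pospow_le0 m.+1 (lexx 0)) subr0 addr0 [_%:A]mulr1 sub0r normrN.
    rewrite normrM normfV.
    have h1 : `|h| <= 1 by near: h; exact: dnbhs0_le.
    have he : `|h| <= e by near: h; exact: dnbhs0_le.
    rewrite ler_pdivrMl ?normr_gt0//.
    apply: (@le_trans _ _ (`|h| ^+ m.+2)).
      rewrite /pospow normrX lerXn2r ?nnegrE//.
      by have [hle|hle] := leP h 0; rewrite ?normr0.
    rewrite exprS ler_wpM2l// (le_trans _ he)// exprS ler_piMr//.
    exact: exprn_ile1.
  by apply: DeriveDef; [apply/cvg_ex; exists 0|exact: cvg_lim H].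
Unshelve. all: by end_near. Qed.

(** * The soft threshold and its square *)

Section soft_threshold.
Variable d : R.
Hypothesis d0 : 0 < d.

(** For [d > 0] this is [sign y] times the positive part of [|y| - d]. *)
Definition soft y : R := pospow 1 (y - d) - pospow 1 (- y - d).

(** The square of [soft], written as a sum of squared positive parts because [soft] itself is not
    differentiable at [d] and [-d]. *)
Definition soft2 y : R := pospow 2 (y - d) + pospow 2 (- y - d).

Lemma soft2E y : soft2 y = soft y ^+ 2.
Proof.
rewrite /soft2 /soft /pospow !expr1.
have [y0|y0] := leP y 0.
  rewrite (max_r (_ : y - d <= 0)); last by move: d0; lra.
  by rewrite expr0n/= sub0r sqrrN add0r.
rewrite (max_r (_ : - y - d <= 0)); last by move: d0; lra.
by rewrite expr0n/= subr0 addr0.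
Qed.

Lemma soft_small y : `|y| < d -> soft y = 0 /\ soft2 y = 0.
Proof.
move=> yd; have sy : soft y = 0.
  rewrite /soft !pospow_le0 ?subrr//; move: yd; rewrite ltr_norml; lra.
by rewrite soft2E sy expr0n.
Qed.

(** Beyond the threshold, expand [(|y| - d)^2]; below it the left side is nonpositive. The loss
    caused by thresholding is thus of order [d]. *)
Lemma soft2_ge y : y ^+ 2 - 2 * d * `|y| <= soft2 y.
Proof.
rewrite soft2E /soft /pospow !expr1.
have [y0|y0] := leP 0 y.
  rewrite (max_r (_ : - y - d <= 0)); last by move: d0; lra.
  by rewrite subr0 ger0_norm//; case: (leP (y - d) 0) => H; nra.
rewrite (max_r (_ : y - d <= 0)); last by move: d0; lra.
by rewrite sub0r sqrrN ltr0_norm//; case: (leP (- y - d) 0) => H; nra.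
Qed.

Lemma is_derive_soft2 y : is_derive y (1 : R) soft2 (2 * soft y).
Proof.
have dl : is_derive y (1 : R) (fun z => z - d) (1 - 0).
  exact: is_derive_sub (is_derive_id y (1 : R)) (is_derive_cst d y (1 : R)).
have dr : is_derive y (1 : R) (fun z => - z - d) (- 1 - 0).
  exact: is_derive_sub (is_deriveNid y (1 : R)) (is_derive_cst d y (1 : R)).
have Dl := @is_derive_chain R R _ (fun z => z - d) y 1 _ _
  (is_derive_pospow 0 (y - d)) dl.
have Dr := @is_derive_chain R R _ (fun z => - z - d) y 1 _ _
  (is_derive_pospow 0 (- y - d)) dr.
have := is_derive_add Dl Dr.
by move=> /is_derive_eq; apply; rewrite /soft; ring.
Qed.

Lemma continuous_soft : continuous soft.
Proof.
have cl : continuous (fun z : R => z - d).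
  by move=> y; apply: cvgB; [exact: cvg_id|exact: cvg_cst].
have cr : continuous (fun z : R => - z - d).
  by move=> y; apply: cvgB; [apply: cvgN; exact: cvg_id|exact: cvg_cst].
move=> y; apply: (@continuous_sub R R (fun z => pospow 1 (z - d))
    (fun z => pospow 1 (- z - d))).
  apply: (continuous_comp (f := fun z => z - d) (g := pospow 1)); first exact: cl.
  exact: continuous_pospow.
apply: (continuous_comp (f := fun z => - z - d) (g := pospow 1)); first exact: cr.
exact: continuous_pospow.
Qed.

End soft_threshold.
End positive_part_powers.

(** * Nonnegativity of the quadratic form under a vanishing condition (Picone) *)

Section morse_form_bounds.
Context {R : realType} (N : nat) (L : R).
Hypothesis L0 : 0 < L.
Implicit Types (x : 'rV[R]_N) (phi : 'rV[R]_N -> R) (D : 'I_N -> 'rV[R]_N -> R).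
Local Notation ball := (@unit_ball R N).
Local Notation mu := (lebesgue_rV N).

(* [f'(u)] for the bubble. *)
Definition potential x : R := N%:R * (N%:R + 2) * L / quad L x ^+ 2.

Lemma potential_ge0 x : 0 <= potential x.
Proof.
by rewrite !mulr_ge0 ?addr_ge0 ?ler0n ?invr_ge0 ?exprn_ge0 ?(ltW L0)// ltW// quad_gt0.
Qed.

Lemma potential_le x : potential x <= N%:R * (N%:R + 2) * L.
Proof.
rewrite ler_piMr//; first by rewrite !mulr_ge0 ?addr_ge0 ?ler0n ?(ltW L0).
by rewrite invf_le1 ?exprn_gt0 ?quad_gt0// exprn_ege1// quad_ge1.
Qed.

Lemma is_derive_inv (f : 'rV[R]_N -> R) x v (a : R) : f x != 0 ->
  is_derive x v f a -> is_derive x v (fun y => (f y)^-1) (- (f x) ^- 2 * a).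
Proof.
by move=> fx [df <-]; split; [exact: derivableV|rewrite deriveV].
Qed.

Lemma continuous_potential : continuous potential.
Proof.
move=> x; apply: (@continuous_scale _ _ _ (fun y => (quad L y ^+ 2)^-1)).
apply: (@continuousV _ _ (fun y => quad L y ^+ 2)).
  by rewrite expf_neq0// gt_eqF// quad_gt0.
by apply: continuous_pow; exact: continuous_quad.
Qed.

(** The integrand of the Morse form; [D] stands for the gradient of [phi], passed separately so that
    an explicit formula can be used for it. *)
Definition energy phi D x : R :=
  \sum_i D i x ^+ 2 - potential x * phi x ^+ 2.

Lemma continuous_energy phi D :
  continuous phi -> (forall i, continuous (D i)) -> continuous (energy phi D).
Proof.
move=> cphi cD x; apply: (@continuous_sub _ _ (fun y => \sum_i D i y ^+ 2)
  (fun y => potential y * phi y ^+ 2)).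
  by apply: continuous_bigsum => i y; apply: continuous_pow; exact: cD.
apply: continuous_mul; first exact: continuous_potential.
by apply: continuous_pow; exact: cphi.
Qed.

(* The radial solution Z = (1 - L |x|^2) (1 + L |x|^2)^(-N/2) of
   -Lap Z = potential Z satisfies grad Z / Z = - (slope x) x. *)
Let defect x : R := 1 - L * sqnorm x.

Let slope x : R := 2 * L / defect x + N%:R * L / quad L x.

(** The derivative of [slope] with respect to [|x|^2]. *)
Let dslope x : R := 2 * L ^+ 2 / defect x ^+ 2 - N%:R * L ^+ 2 / quad L x ^+ 2.

(** The Riccati equation [div v + |v|^2 = - potential] of [v = grad Z / Z = - (slope x) x], obtained
    from [-Lap Z = potential Z] on division by [Z]. *)
Let slope_riccati x : defect x != 0 ->
  N%:R * slope x + 2 * sqnorm x * dslope x =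
  sqnorm x * slope x ^+ 2 + potential x.
Proof.
have := gt_eqF (quad_gt0 L0 x) => /negbT.
rewrite /slope /dslope /potential /defect /quad => q0 d0; field.
by rewrite q0 d0.
Qed.

Let is_derive_defect x i : is_derive x (base i) defect (- (L * (2 * x ord0 i))).
Proof.
have := is_derive_sub (is_derive_cst (1 : R) x (base i))
  (is_derive_scale L (is_derive_sqnorm x i)).
by rewrite sub0r.
Qed.

Let continuous_defect : continuous defect.
Proof.
move=> x; apply: (@continuous_sub _ _ (cst 1) (fun y => L * sqnorm y)).
  exact: cst_continuous.
by apply: continuous_scale; exact: continuous_sqnorm.
Qed.

Let is_derive_slope x i : defect x != 0 ->
  is_derive x (base i) slope (dslope x * (2 * x ord0 i)).
Proof.
move=> d0; have q0 : quad L x != 0 by rewrite gt_eqF// quad_gt0.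
have := is_derive_add
  (is_derive_scale (2 * L) (is_derive_inv d0 (is_derive_defect x i)))
  (is_derive_scale (N%:R * L) (is_derive_inv q0 (is_derive_quad L x i))).
by move=> /is_derive_eq; apply; rewrite /dslope; field; rewrite q0 d0.
Qed.

Let continuous_slope x : defect x != 0 -> {for x, continuous slope}.
Proof.
move=> d0; have q0 : quad L x != 0 by rewrite gt_eqF// quad_gt0.
apply: (@continuous_add _ _ (fun y => 2 * L / defect y)
  (fun y => N%:R * L / quad L y)); apply: continuous_scale; apply: continuousV => //.
  exact: continuous_defect.
exact: continuous_quad.
Qed.

Let continuous_dslope x : defect x != 0 -> {for x, continuous dslope}.
Proof.
move=> d0; have q0 : quad L x != 0 by rewrite gt_eqF// quad_gt0.
apply: (@continuous_sub _ _ (fun y => 2 * L ^+ 2 / defect y ^+ 2)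
  (fun y => N%:R * L ^+ 2 / quad L y ^+ 2)); apply: continuous_scale;
  apply: continuousV; rewrite ?expf_neq0//; apply: continuous_pow.
  exact: continuous_defect.
exact: continuous_quad.
Qed.

(* Completing the square, [|grad phi|^2 - potential phi^2 - div F] with
   [F = soft2 phi (grad Z / Z)] is
   [|grad phi - soft phi (grad Z / Z)|^2 - potential (phi^2 - soft2 phi)].
   The threshold makes [F] vanish near the zero set of [Z]. *)
Lemma energy_ge0 phi D :
  (forall i x, is_derive x (base i) phi (D i x)) ->
  continuous phi -> (forall i, continuous (D i)) ->
  (forall x, ~ ball x -> phi x = 0 /\ forall i, D i x = 0) ->
  (forall x, L * sqnorm x = 1 -> phi x = 0) ->
  (0 <= \int[mu]_x (energy phi D x)%:E)%E.
Proof.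
move=> phiD cphi cD phi0 phiS.
have [B B0 phiB] : exists2 B, 0 <= B & forall x, `|phi x| <= B.
  by apply: continuous_ball_bounded => // x /phi0[].
(* [d * C] is the total error at threshold [d]: the bound of [potential], times the bound [2 d B] of
   [phi^2 - soft2 d phi], times the volume [2^N] of the cube. *)
pose C := N%:R * (N%:R + 2) * L * (2 * B) * 2 ^+ N.
have C0 : 0 <= C by rewrite !mulr_ge0 ?addr_ge0 ?ler0n ?(ltW L0)// exprn_ge0.
suff H d : 0 < d -> ((- (d * C))%:E <= \int[mu]_x (energy phi D x)%:E)%E.
  rewrite leNgt; apply/negP => I0.
  have /fineK IE : (\int[mu]_x (energy phi D x)%:E)%E \is a fin_num.
    apply: integrable_fin_num => //; apply: continuous_ball_integrable.
      exact: continuous_energy.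
    move=> x /phi0[px Dx]; rewrite /energy px expr0n mulr0 subr0 big1// => i _.
    by rewrite Dx expr0n.
  move: I0 H; rewrite -IE lte_fin; set I := fine _ => I0 H.
  (* The threshold goes to 0: were the integral [I] negative, [d = - I / (2 (C + 1))] would give
     [d C < - I], against the bound for that [d]. *)
  have dp : 0 < - I / (C + 1) / 2 by rewrite !divr_gt0// ?oppr_gt0// ltr_wpDl.
  have := H _ dp; rewrite lee_fin lerNl leNgt => /negP; apply.
  rewrite (_ : _ * C = - I * (C / (C + 1) / 2)); last by ring.
  rewrite -[ltRHS]mulr1 ltr_pM2l ?oppr_gt0// ltr_pdivrMr// ltr_pdivrMr ?ltr_wpDl//.
  by move: C0; lra.
move=> d0.
pose F i x := - (soft2 d (phi x) * (x ord0 i * slope x)).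
pose dF i x := - (soft2 d (phi x) * (x ord0 i * (dslope x * (2 * x ord0 i)) + slope x)
  + x ord0 i * slope x * (2 * soft d (phi x) * D i x)).
have small x : defect x = 0 -> \forall y \near x, `|phi y| < d.
  move=> /eqP; rewrite subr_eq0 eq_sym => /eqP/phiS px.
  have : \forall z \near phi x, `|z| < d.
    rewrite px; apply/nbhs_ballP; exists d => // z; rewrite -ball_normE/= sub0r.
    by rewrite normrN.
  exact: cphi.
have -> : (- (d * C))%:E = (- (N%:R * (N%:R + 2) * L * (2 * d * B) * 2 ^+ N))%:E.
  by rewrite /C; congr (- _)%:E; ring.
apply: (@integral_divergence_ge _ _ F dF).
- move=> i x; have [dx|dx] := eqVneq (defect x) 0.
    have [s0 t0] := soft_small d0 (nbhs_singleton (small x dx)).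
    rewrite /dF s0 t0 mulr0 mul0r mulr0 mul0r addr0 oppr0.
    apply: (@near_eq_is_derive R _ _ (cst 0) (F i)).
    by apply: filterS (small x dx) => y /(soft_small d0)[_ ty]; rewrite /F ty mul0r oppr0.
  apply: is_derive_eq (is_deriveN (is_derive_mul
    (@is_derive_chain _ _ _ phi x _ _ _ (is_derive_soft2 d (phi x)) (phiD i x))
    (is_derive_mul (is_derive_coord x i i) (is_derive_slope i dx)))) _.
  by rewrite /dF eqxx mulr1.
- move=> i x; have [dx|dx] := eqVneq (defect x) 0.
    apply: (@continuous_near_cst _ _ _ 0).
    apply: filterS (small x dx) => y /(soft_small d0)[sy ty].
    by rewrite /dF sy ty mulr0 !mul0r mulr0 addr0 oppr0.
  have cx : {for x, continuous (fun y : 'rV[R]_N => y ord0 i)}.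
    exact: continuous_coord.
  have cs : {for x, continuous slope} := continuous_slope dx.
  have cds : {for x, continuous dslope} := continuous_dslope dx.
  have csoft : {for x, continuous (fun y => soft d (phi y))}.
    apply: (continuous_comp (f := phi) (g := soft d)); first exact: cphi.
    exact: continuous_soft.
  have csoft2 : {for x, continuous (fun y => soft2 d (phi y))}.
    apply: (continuous_comp (f := phi) (g := soft2 d)); first exact: cphi.
    exact: is_derive1_continuous (is_derive_soft2 d (phi x)).
  suff : {for x, continuous (fun y => soft2 d (phi y) *
        (y ord0 i * (dslope y * (2 * y ord0 i)) + slope y)
      + y ord0 i * slope y * (2 * soft d (phi y) * D i y))}.
    exact: continuousN.
  apply: continuous_add; apply: continuous_mul => //.
  + apply: continuous_add => //; apply: continuous_mul => //.
    by apply: continuous_mul => //; exact: continuous_scale.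
  + exact: continuous_mul.
  + by apply: continuous_mul; [exact: continuous_scale|exact: cD].
- move=> i x /phi0[px Dx].
  have [sx tx] : soft d (phi x) = 0 /\ soft2 d (phi x) = 0.
    by apply: soft_small => //; rewrite px normr0.
  by rewrite /F /dF sx tx mulr0 !mul0r mulr0 addr0 oppr0.
- exact: continuous_energy.
- move=> x /phi0[px Dx]; rewrite /energy px expr0n mulr0 subr0 big1// => i _.
  by rewrite Dx expr0n.
- by rewrite !mulr_ge0 ?addr_ge0 ?ler0n ?(ltW L0) ?(ltW d0).
- move=> x; have [dx|dx] := eqVneq (defect x) 0.
    have [sx tx] := soft_small d0 (nbhs_singleton (small x dx)).
    have px : phi x = 0.
      by apply: phiS; move/eqP: dx; rewrite subr_eq0 eq_sym => /eqP.
    rewrite big1 => [|i _]; last by rewrite /dF sx tx mulr0 !mul0r mulr0 addr0 oppr0.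
    rewrite /energy px expr0n mulr0 subr0 sub0r.
    apply: (@le_trans _ _ 0).
      by rewrite oppr_le0 !mulr_ge0 ?addr_ge0 ?ler0n ?(ltW L0) ?(ltW d0).
    by apply: sumr_ge0 => i _; exact: sqr_ge0.
  set e := N%:R * _ * _ * _.
  (* The cross terms of the square come from differentiating [soft2 d phi] in [F]; the terms free of
     [D] combine into the potential by the Riccati equation. *)
  have sq : \sum_i (D i x + soft d (phi x) * slope x * x ord0 i) ^+ 2 =
      \sum_i D i x ^+ 2 - \sum_i dF i x
      - potential x * soft2 d (phi x).
    have -> : potential x * soft2 d (phi x) =
        \sum_i (soft2 d (phi x) * (slope x + 2 * dslope x * x ord0 i ^+ 2
          - slope x ^+ 2 * x ord0 i ^+ 2)).
      rewrite -mulr_sumr sumrB big_split/= sumr_const card_ord -!mulr_sumr.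
      rewrite -[_ *+ N]mulr_natl -/(sqnorm x) mulrC; congr (_ * _).
      by have := slope_riccati dx; lra.
    rewrite -!sumrB; apply: eq_bigr => i _.
    by rewrite /dF soft2E//; ring.
  have : 0 <= \sum_i (D i x + soft d (phi x) * slope x * x ord0 i) ^+ 2.
    by apply: sumr_ge0 => i _; exact: sqr_ge0.
  rewrite sq => sq0.
  have : potential x * phi x ^+ 2 - potential x * soft2 d (phi x) <= e.
    rewrite -mulrBr; apply: (@le_trans _ _ (potential x * (2 * d * B))).
      rewrite ler_wpM2l ?potential_ge0// lerBlDl -lerBlDr.
      apply: le_trans (soft2_ge d0 (phi x)).
      by rewrite lerD2l lerN2 ler_wpM2l// mulr_ge0// ltW.
    by rewrite ler_wpM2r ?potential_le// !mulr_ge0// ltW.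
  by move: sq0; rewrite /energy; lra.
Qed.

End morse_form_bounds.

(** * A compactly supported radial function of negative energy *)

Section negative_direction.
Context {R : realType} (m : nat) (L : R).
Hypothesis m6 : (m <= 6)%N.
Hypothesis L9 : 9 <= L.
Local Notation N := m.+3.
Implicit Types (x : 'rV[R]_N).
Local Notation ball := (@unit_ball R N).
Local Notation mu := (lebesgue_rV N).

Let L0 : 0 < L. Proof. by move: L9; lra. Qed.

Let gap x : R := 4 - L * sqnorm x.

Definition bump x : R := pospow m.+3 (gap x).

Definition dbump (i : 'I_N) x : R :=
  - (m.+3%:R * pospow m.+2 (gap x) * (L * (2 * x ord0 i))).

Let ddbump (i : 'I_N) x : R :=
  m.+3%:R * m.+2%:R * pospow m.+1 (gap x) * (L * (2 * x ord0 i)) ^+ 2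
  - m.+3%:R * pospow m.+2 (gap x) * (L * 2).

Let is_derive_gap x i : is_derive x (base i) gap (- (L * (2 * x ord0 i))).
Proof.
have := is_derive_sub (is_derive_cst (4 : R) x (base i))
  (is_derive_scale L (is_derive_sqnorm x i)).
by rewrite sub0r.
Qed.

Let continuous_pospow_gap k : continuous (fun x => pospow k (gap x)).
Proof.
have cgap : continuous gap.
  move=> x; apply: (@continuous_sub _ _ (cst 4) (fun y => L * sqnorm y)).
    exact: cst_continuous.
  by apply: continuous_scale; exact: continuous_sqnorm.
move=> x; apply: (continuous_comp (f := gap) (g := pospow k)); first exact: cgap.
exact: continuous_pospow.
Qed.

Lemma is_derive_bump i x : is_derive x (base i) bump (dbump i x).
Proof.
have := @is_derive_chain _ _ _ gap x _ _ _ (is_derive_pospow m.+1 (gap x))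
  (is_derive_gap x i).
by move=> /is_derive_eq; apply; rewrite /dbump mulrN.
Qed.

Let is_derive_dbump i x : is_derive x (base i) (dbump i) (ddbump i x).
Proof.
have dg := @is_derive_chain _ _ _ gap x _ _ _ (is_derive_pospow m (gap x))
  (is_derive_gap x i).
have dx := is_derive_scale L (is_derive_scale 2 (is_derive_coord x i i)).
have := is_deriveN (is_derive_mul (is_derive_scale m.+3%:R dg) dx).
by move=> /is_derive_eq; apply; rewrite /ddbump eqxx/=; ring.
Qed.

Lemma continuous_bump : continuous bump.
Proof. exact: continuous_pospow_gap. Qed.

Lemma continuous_dbump i : continuous (dbump i).
Proof.
move=> x; suff : {for x, continuous (fun y : 'rV[R]_N =>
    m.+3%:R * pospow m.+2 (gap y) * (L * (2 * y ord0 i)))} by exact: continuousN.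
apply: continuous_mul; first by apply: continuous_scale; exact: continuous_pospow_gap.
by do 2 apply: continuous_scale; exact: continuous_coord.
Qed.

Let continuous_ddbump i : continuous (ddbump i).
Proof.
move=> x; apply: (@continuous_sub _ _ (fun y : 'rV[R]_N =>
    m.+3%:R * m.+2%:R * pospow m.+1 (gap y) * (L * (2 * y ord0 i)) ^+ 2)
  (fun y => m.+3%:R * pospow m.+2 (gap y) * (L * 2))).
  apply: continuous_mul; first by apply: continuous_scale; exact: continuous_pospow_gap.
  by apply: continuous_pow; do 2 apply: continuous_scale; exact: continuous_coord.
apply: continuous_mul; last exact: cst_continuous.
by apply: continuous_scale; exact: continuous_pospow_gap.
Qed.

(** With [L >= 9] the radius [2 L^(-1/2)] of the support is at most [2/3], so the support is compact
    in the open ball. *)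
Lemma bump_support x : 4 / 9 <= sqnorm x -> bump x = 0 /\ forall i, dbump i x = 0.
Proof.
move=> sx; have g0 : gap x <= 0.
  by rewrite /gap; have := sqnorm_ge0 x; move: L9 sx; nra.
split=> [|i]; first by rewrite /bump pospow_le0.
by rewrite /dbump pospow_le0// mulr0 mul0r oppr0.
Qed.

Let bump_ball x : ~ ball x -> bump x = 0 /\ forall i, dbump i x = 0.
Proof.
move=> bx; apply: bump_support; rewrite leNgt; apply/negP => xs; apply: bx.
by apply/unit_ballE; move: xs; lra.
Qed.

(* For 3 <= N <= 9 the bump satisfies -Lap bump <= potential bump; the
   resulting cubic inequality is affine in N. *)
Let subsolution_cubic (n y : R) : 3 <= n -> n <= 9 -> 0 <= y -> y <= 4 ->
  0 <= (n + 2) * (4 - y) ^+ 2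
    + (4 * (n - 1) * y - 2 * n * (4 - y)) * (1 + y) ^+ 2.
Proof.
move=> n3 n9 y0 y4.
(* [A3] and [A9] are the endpoint cases [n = 3] and [n = 9]. The squares are centred at rational
   points close to the positive minimizers of the two cubics. *)
have A3 : 0 <= 14 * y ^+ 3 + 9 * y ^+ 2 - 74 * y + 56.
  have : 0 <= y * (y - 9 / 8) ^+ 2 by rewrite mulr_ge0 ?sqr_ge0.
  have : 0 <= (y - 9 / 8) ^+ 2 by rewrite sqr_ge0.
  by rewrite !exprS expr0; lra.
have A9 : 0 <= 50 * y ^+ 3 + 39 * y ^+ 2 - 182 * y + 104.
  have : 0 <= y * (y - 7 / 8) ^+ 2 by rewrite mulr_ge0 ?sqr_ge0.
  have : 0 <= (y - 7 / 8) ^+ 2 by rewrite sqr_ge0.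
  by rewrite !exprS expr0; lra.
have -> : (n + 2) * (4 - y) ^+ 2
    + (4 * (n - 1) * y - 2 * n * (4 - y)) * (1 + y) ^+ 2 =
    (9 - n) / 6 * (14 * y ^+ 3 + 9 * y ^+ 2 - 74 * y + 56) +
    (n - 3) / 6 * (50 * y ^+ 3 + 39 * y ^+ 2 - 182 * y + 104) by field.
by rewrite addr_ge0// mulr_ge0//; lra.
Qed.

(** [bump (Lap bump + potential bump)], the amount by which the divergence of [bump grad bump]
    exceeds the energy density. *)
Let excess x : R := bump x * (\sum_i ddbump i x + potential L x * bump x).

(** The exponent [N] of the bump lets [N L] factor out of all three terms; where [gap x > 0], what
    remains is the cubic of [subsolution_cubic] at [y = L |x|^2]. *)
Let excessE x : excess x = bump x * (L * N%:R * pospow m.+1 (gap x)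
  / quad L x ^+ 2 * ((N%:R + 2) * Num.max (gap x) 0 ^+ 2
   + (4 * (N%:R - 1) * (L * sqnorm x) - 2 * N%:R * Num.max (gap x) 0)
     * quad L x ^+ 2)).
Proof.
have q0 : quad L x != 0 by rewrite gt_eqF// quad_gt0.
rewrite /excess; congr (_ * _); rewrite /ddbump sumrB sumr_const card_ord.
under eq_bigr => i _ do rewrite exprMn exprMn mulrA.
rewrite -!mulr_sumr -/(sqnorm x) /potential /bump /pospow.
rewrite (exprS _ m.+2) (exprS _ m.+1) -[_ * (L * 2) *+ _]mulr_natr.
have -> : m.+2%:R = m.+3%:R - 1 :> R by rewrite -[m.+3]addn1 natrD addrK.
set P := Num.max _ _; set Q := P ^+ m.+1; field.
by rewrite q0.
Qed.

Let excess_ge0 x : 0 <= excess x.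
Proof.
rewrite excessE mulr_ge0 ?pospow_ge0//.
have [g0|g0] := leP (gap x) 0; first by rewrite pospow_le0// mulr0 mul0r mul0r.
rewrite mulr_ge0//.
  by rewrite divr_ge0 ?exprn_ge0 ?mulr_ge0 ?pospow_ge0 ?ler0n ?(ltW (quad_gt0 L0 _)) ?(ltW L0).
apply: subsolution_cubic.
- by rewrite ler_nat.
- by rewrite ler_nat.
- by rewrite mulr_ge0 ?sqnorm_ge0// ltW.
- by move: g0; rewrite /gap; lra.
Qed.

Let continuous_excess : continuous excess.
Proof.
move=> x; apply: (@continuous_mul _ _ bump
  (fun y => \sum_i ddbump i y + potential L y * bump y)).
  exact: continuous_bump.
apply: continuous_add; first exact: continuous_bigsum.
by apply: continuous_mul; [exact: continuous_potential|exact: continuous_bump].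
Qed.

Lemma bump0_gt0 : 0 < bump 0.
Proof.
rewrite /bump /pospow /gap /sqnorm big1 => [|i _]; last by rewrite mxE expr0n.
by rewrite mulr0 subr0 max_l// exprn_gt0.
Qed.

(** The divergence of [bump grad bump] integrates to zero, so the energy is minus the integral of
    [excess], which is nonnegative, continuous, and positive at the origin. *)
Lemma bump_energy_lt0 : (\int[mu]_x (energy L bump dbump x)%:E < 0)%E.
Proof.
pose F i x := bump x * dbump i x.
pose dF i x := bump x * ddbump i x + dbump i x * dbump i x.
have FdF i x : is_derive x (base i) (F i) (dF i x).
  exact: is_derive_mul (is_derive_bump i x) (is_derive_dbump i x).
have cdF i : continuous (dF i).
  move=> x; apply: (@continuous_add _ _ (fun y => bump y * ddbump i y)
    (fun y => dbump i y * dbump i y)); apply: continuous_mul.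
  - exact: continuous_bump.
  - exact: continuous_ddbump.
  - exact: continuous_dbump.
  - exact: continuous_dbump.
have F0 i x : ~ ball x -> F i x = 0 /\ dF i x = 0.
  by move=> /bump_ball[bx dx]; rewrite /F /dF bx dx !mul0r addr0.
have idF : mu.-integrable setT (EFin \o (fun x => \sum_i dF i x)).
  apply: continuous_ball_integrable; first exact: continuous_bigsum.
  by move=> x xb; apply: big1 => i _; exact: (F0 i x xb).2.
have e0 x : ~ ball x -> excess x = 0.
  by move=> /bump_ball[bx _]; rewrite /excess bx mul0r.
have ie := continuous_ball_integrable continuous_excess e0.
have -> : (\int[mu]_x (energy L bump dbump x)%:E =
    \int[mu]_x ((\sum_i dF i x)%:E - (excess x)%:E))%E.
  apply: eq_integral => x _; rewrite -EFinB; congr EFin.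
  rewrite /dF big_split/= -mulr_sumr /excess /energy.
  by under [X in X - _]eq_bigr do rewrite expr2; ring.
rewrite integralB//= (divergence_ball FdF cdF F0) sub0e oppe_lt0.
apply: integral_gt0_ball => //.
rewrite excessE mulr_gt0 ?bump0_gt0//.
have s0 : sqnorm (0 : 'rV[R]_N) = 0 by apply: big1 => i _; rewrite mxE expr0n.
rewrite /quad /gap /pospow s0 mulr0 subr0 addr0 max_l// expr1n divr1.
have n3 : 3 <= N%:R :> R by rewrite ler_nat.
rewrite mulr_gt0 ?exprn_gt0//; first by rewrite !mulr_gt0 ?exprn_gt0 ?ltr0n.
by move: n3; lra.
Qed.

End negative_direction.

(** * Integrals of products of one-variable functions *)

Section product_bound.
Context {R : realType}.
Local Notation leb := (@lebesgue_measure R).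

(** Tonelli, one coordinate at a time; in dimension 0 the empty product has integral 1 for the Dirac
    mass. *)
Lemma integral_prod_coord_le n (w : R -> R) (K : R) :
  measurable_fun setT w -> (forall t, 0 <= w t) -> 0 <= K ->
  (\int[leb]_t (w t)%:E <= K%:E)%E ->
  (\int[lebesgue_rV n]_x (\prod_i w (x ord0 i))%:E <= (K ^+ n)%:E)%E.
Proof.
move=> mw w0 K0 wK; elim: n => [|n IHn].
  under eq_integral do rewrite big_ord0.
  rewrite (_ : (fun=> 1%:E) = cst 1%E)// integral_cst// mul1e/=.
  by rewrite diracT.
have mprod k : measurable_fun setT (fun x : 'rV[R]_k => \prod_i w (x ord0 i)).
  apply: measurable_prod => i _.
  by apply: (measurableT_comp mw); exact: measurable_coord.
rewrite ge0_lebesgue_rV_fubini//; last by move=> x; exact: prodr_ge0.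
set I := (\int[lebesgue_rV n]_x (\prod_i w (x ord0 i))%:E)%E in IHn.
have I0 : (0 <= I)%E by apply: integral_ge0 => x _; rewrite lee_fin prodr_ge0.
have IE : ((fine I)%:E = I)%E.
  by rewrite fineK// ge0_fin_numE// (le_lt_trans IHn)// ltry.
have inner a : (\int[lebesgue_rV n]_y
    (\prod_i w (cons_rV (a, y) ord0 i))%:E = (fine I)%:E * (w a)%:E)%E.
  rewrite IE muleC /I -ge0_integralZl_EFin//; last 2 first.
  - by move=> x _; rewrite lee_fin prodr_ge0.
  - by apply/measurable_EFinP; exact: mprod.
  apply: eq_integral => y _; rewrite big_ord_recl cons_rV0 -EFinM.
  by congr (_ * _)%:E; apply: eq_bigr => i _; rewrite cons_rVS.
under eq_integral do rewrite inner.
rewrite ge0_integralZl_EFin ?fine_ge0//; last 2 first.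
- by move=> t _; rewrite lee_fin.
- exact/measurable_EFinP.
rewrite IE exprSr EFinM lee_pmul// integral_ge0// => t _.
by rewrite lee_fin.
Qed.

End product_bound.

(** * The one-dimensional weight that dominates the bubble *)

Section bubble_norms.
Context {R : realType}.
Local Notation leb := (@lebesgue_measure R).

Section one_dimensional_weight.
Variables (L g : R).
Hypotheses (L0 : 0 < L) (g0 : 0 <= g) (g1 : g < 1).

Let base1 (t : R) : R := 1 + L * t ^+ 2.

Let base1_gt0 t : 0 < base1 t.
Proof. by rewrite ltr_pwDl// mulr_ge0 ?sqr_ge0// ltW. Qed.

(** One factor of the product bounding a power of the bubble, each coordinate taking an equal share
    [g = b / N] of the decay exponent [b]; the indicator restricts to the cube that contains the
    ball. *)
Definition weight (t : R) : R :=
  \1_[set` `[- 1, 1]%R] t * (1 + L * t ^+ 2) `^ (- (g / 2)).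

Lemma weight_ge0 t : 0 <= weight t.
Proof. by rewrite mulr_ge0 ?powR_ge0// indicE ler0n. Qed.

Let is_derive_base1 t : is_derive t (1 : R) base1 (L * (2 * t)).
Proof.
have := is_derive_add (is_derive_cst (1 : R) t (1 : R))
  (is_derive_scale L (is_derive_exp 2 (is_derive_id t (1 : R)))).
by rewrite add0r mulr1.
Qed.

Let continuous_base1 : continuous base1.
Proof. move=> t; exact: is_derive1_continuous (is_derive_base1 t). Qed.

Let pw b t := base1 t `^ b.

Let is_derive_pw b t : is_derive t (1 : R) (pw b)
  (b * pw (b - 1) t * (L * (2 * t))).
Proof.
apply: (@is_derive_chain _ _ (fun y => y `^ b) base1); last exact: is_derive_base1.
exact/is_derive1_powR/base1_gt0.
Qed.

Let continuous_pw b : continuous (pw b).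
Proof. move=> t; exact: is_derive1_continuous (is_derive_pw b t). Qed.

Lemma measurable_weight : measurable_fun setT weight.
Proof.
apply: measurable_funM; first exact: measurable_indic.
by apply: continuous_measurable_fun; exact: continuous_pw.
Qed.

(* [t (1 + L t^2)^(-g/2) / (1 - g)] has a derivative at least
   [(1 + L t^2)^(-g/2)]. *)
Lemma integral_weight_le : (\int[leb]_t (weight t)%:E <=
  (2 / (1 - g) * (1 + L) `^ (- (g / 2)))%:E)%E.
Proof.
have g10 : 0 < 1 - g by rewrite subr_gt0.
pose b := - (g / 2).
pose H t := (1 - g)^-1 * (t * pw b t).
pose dH t := (1 - g)^-1 * (t * (b * pw (b - 1) t * (L * (2 * t))) + pw b t * 1).
have dHE t : is_derive t (1 : R) H (dH t).
  exact: is_derive_scale (is_derive_mul (is_derive_id t (1 : R)) (is_derive_pw b t)).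
have cdH : continuous dH.
  move=> t; apply: (@continuous_scale _ _ _ (fun t : R =>
    t * (b * pw (b - 1) t * (L * (2 * t))) + pw b t * 1)).
  have ct : {for t, continuous (fun s : R => s)} by exact: cvg_id.
  apply: continuous_add; apply: continuous_mul => //.
  - apply: continuous_mul; last by do 2 apply: continuous_scale.
    by apply: continuous_scale; exact: continuous_pw.
  - exact: continuous_pw.
  - exact: cst_continuous.
(* After multiplication by [1 - g] the difference of the two sides is [pw (b - 1)] times
   [g (1 + L t^2) - g L t^2 = g]. *)
have pw_dH t : pw b t <= dH t.
  rewrite /dH -ler_pdivrMl ?invr_gt0// invrK mulr1.
  have -> : pw b t = pw (b - 1) t * base1 t.
    rewrite /pw -[X in _ = _ * X](powRr1 (ltW (base1_gt0 t))) -powRD.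
      by rewrite subrK.
    by rewrite (gt_eqF (base1_gt0 t)) implybT.
  rewrite -subr_ge0.
  rewrite (_ : _ - _ = pw (b - 1) t * g); first by rewrite mulr_ge0 ?powR_ge0.
  by rewrite /b /base1; field.
rewrite (_ : (2 / (1 - g) * _)%:E = (H 1)%:E - (H (- 1))%:E)%E; last first.
  rewrite -EFinB; congr EFin; rewrite /H /pw /base1 sqrrN expr1n mulr1 mul1r mulN1r.
  by field; rewrite gt_eqF.
have <- := @continuous_FTC2 R dH H (- 1) 1.
- rewrite [leRHS]integral_mkcond; apply: ge0_le_integral => //.
  + by move=> t _; rewrite lee_fin weight_ge0.
  + by apply/measurable_EFinP; exact: measurable_weight.
  + apply/(measurable_restrictT _ _).1 => //; apply/measurable_EFinP.
    by apply: measurable_funTS; exact: continuous_measurable_fun.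
  move=> t _; rewrite patchE /weight indicE; case: ifPn => _.
    by rewrite mul1r lee_fin; exact: pw_dH.
  by rewrite mul0r.
- by rewrite ltrN10 || lra.
- exact: continuous_subspaceT.
- split=> [t _||]; first by case: (dHE t).
  + by apply: cvg_at_right_filter; exact: is_derive1_continuous (dHE _).
  + by apply: cvg_at_left_filter; exact: is_derive1_continuous (dHE _).
- by move=> t _; exact: is_derive1_val (dHE t).
Qed.

End one_dimensional_weight.
End bubble_norms.

(** * Upper and lower bounds for the norms of the bubble on the ball *)

Section bubble_norms_on_the_ball.
Context {R : realType} (N : nat) (L : R).
Hypothesis N3 : (3 <= N)%N.
Hypothesis L9 : 9 <= L.
Local Notation mu := (lebesgue_rV N).
Implicit Types (x : 'rV[R]_N).

Let L0 : 0 < L. Proof. by move: L9; lra. Qed.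

Let NR3 : 3 <= N%:R :> R. Proof. by rewrite ler_nat. Qed.

Definition bubble x : R :=
  quad L x `^ (1 - N%:R / 2) - (1 + L) `^ (1 - N%:R / 2).

Lemma quad_le x : unit_ball x -> quad L x <= 1 + L.
Proof.
by move=> /unit_ballE xb; rewrite lerD2l ler_piMr ?ltW.
Qed.

Let powRN_le (a b c : R) : 0 < a -> a <= b -> c <= 0 -> b `^ c <= a `^ c.
Proof.
move=> a0 ab c0; have b0 := lt_le_trans a0 ab.
rewrite -[c]opprK !(powRN _ (- c)) lef_pV2 ?posrE ?powR_gt0//.
by apply: ge0_ler_powR; rewrite ?nnegrE ?oppr_ge0// ltW.
Qed.

Let expo_le0 : 1 - N%:R / 2 <= 0 :> R. Proof. by move: NR3; lra. Qed.

Lemma bubble_ge0 x : unit_ball x -> 0 <= bubble x.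
Proof. by move=> xb; rewrite subr_ge0 powRN_le ?quad_gt0// quad_le. Qed.

Let bubble_le x : bubble x <= quad L x `^ (1 - N%:R / 2).
Proof. by rewrite gerBl powR_ge0. Qed.

Let U x : R := bubble x * \1_(@unit_ball R N) x.

Let U_ge0 x : 0 <= U x.
Proof.
rewrite /U indicE; have [xb|xb] := pselect (unit_ball x).
  by rewrite mem_set// mulr1 bubble_ge0.
by rewrite memNset// mulr0.
Qed.

Let measurable_U : measurable_fun setT U.
Proof.
apply: measurable_funM; last by apply: measurable_indic; exact: measurable_unit_ball.
apply: continuous_measurable_rV => x.
apply: (@continuous_sub _ _ (fun y => quad L y `^ (1 - N%:R / 2))
  (cst ((1 + L) `^ (1 - N%:R / 2)))); last exact: cst_continuous.
exact: continuous_quad_pow.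
Qed.

Let I (s : R) := (\int[mu]_x (U x `^ s)%:E)%E.

Let measurable_Us s : measurable_fun setT (fun x => U x `^ s).
Proof. by apply: (measurableT_comp (measurable_powR s)). Qed.

Let I_ge0 s : (0 <= I s)%E.
Proof. by apply: integral_ge0 => x _; rewrite lee_fin powR_ge0. Qed.

Lemma expr_le_prod (F : 'I_N -> R) (t : R) :
  0 <= t -> (forall i, t <= F i) -> t ^+ N <= \prod_i F i.
Proof.
move=> t0 tF; rewrite -[in X in X <= _](card_ord N) -prodr_const.
by apply: ler_prod => i _; rewrite t0 tF.
Qed.

(* [U^s <= (1 + L |x|^2)^(-N g / 2) <= prod_i (1 + L x_i^2)^(-g / 2)]. *)
Lemma integral_bubble_pow_le (s g : R) : 0 < s -> 0 <= g -> g < 1 -> N%:R * g <= s * (N%:R - 2) ->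
  (I s <= ((2 / (1 - g) * (1 + L) `^ (- (g / 2))) ^+ N)%:E)%E.
Proof.
move=> s0 g0 g1 gs.
have K0 : 0 <= 2 / (1 - g) * (1 + L) `^ (- (g / 2)).
  by rewrite mulr_ge0 ?powR_ge0// divr_ge0// subr_ge0 ltW.
have IK := integral_prod_coord_le N (measurable_weight g L0)
  (weight_ge0 L g) K0 (integral_weight_le L0 g0 g1).
apply: (le_trans _ IK).
apply: ge0_le_integral => //.
- by move=> x _; rewrite lee_fin powR_ge0.
- exact/measurable_EFinP.
- apply/measurable_EFinP; apply: measurable_prod => i _.
  by apply: (measurableT_comp (measurable_weight g L0)); exact: measurable_coord.
move=> x _; rewrite lee_fin /U indicE.
have w0 i : 0 <= weight L g (x ord0 i) by exact: weight_ge0.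
have [xb|xb] := pselect (unit_ball x); last first.
  by rewrite memNset// mulr0 powR0 ?gt_eqF// prodr_ge0.
rewrite mem_set// mulr1.
have q0 := quad_gt0 L0 x; have q1 := quad_ge1 L0 x.
apply: (@le_trans _ _ ((quad L x `^ (- (g / 2))) ^+ N)).
  rewrite -powR_mulrn ?powR_ge0// -powRrM.
  apply: (@le_trans _ _ ((quad L x `^ (1 - N%:R / 2)) `^ s)).
    by apply: ge0_ler_powR; rewrite ?nnegrE ?powR_ge0 ?bubble_ge0// ltW.
  by rewrite -powRrM; apply: ler_powR => //; move: gs; lra.
apply: expr_le_prod => [|i]; first exact: powR_ge0.
rewrite /weight indicE mem_set ?mul1r.
  apply: powRN_le.
  - by rewrite ltr_pwDl// mulr_ge0 ?sqr_ge0// ltW.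
  - by rewrite lerD2l ler_wpM2l ?(ltW L0)// sqr_coord_le_sqnorm.
  - by rewrite oppr_le0 divr_ge0.
by rewrite /= in_itv/= -ler_norml; exact: unit_ball_cube.
Qed.

(** A lower bound of the bubble on [L |x|^2 <= 1], uniform in [L >= 9]: there [quad L x <= 2], while
    [1 + L >= 10], and the exponent is negative. *)
Definition bubble_core : R := 2 `^ (1 - N%:R / 2) - 10 `^ (1 - N%:R / 2).

Lemma bubble_core_gt0 : 0 < bubble_core.
Proof.
rewrite subr_gt0 -[1 - _]opprK opprB !(powRN _ (_ - 1)) ltf_pV2 ?posrE ?powR_gt0//.
by apply: gt0_ltr_powR; rewrite ?nnegrE//; move: NR3; lra.
Qed.

Lemma bubble_core_le (r : R) x : 0 <= r -> L * N%:R * r ^+ 2 <= 1 -> cube r x ->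
  bubble_core <= U x.
Proof.
move=> r0 Lr xr.
have sx : L * sqnorm x <= 1.
  apply: le_trans Lr; rewrite -mulrA ler_wpM2l ?(ltW L0)//.
  apply: (@le_trans _ _ (\sum_(i < N) r ^+ 2)).
    by apply: ler_sum => i _; rewrite -(ger0_norm (sqr_ge0 _)) normrX lerXn2r ?nnegrE.
  by rewrite sumr_const card_ord mulr_natl.
have xb : unit_ball x.
  by apply/unit_ballE; move: sx (sqnorm_ge0 x); move: L9; nra.
rewrite /U indicE mem_set// mulr1 /bubble_core /bubble lerB//.
  by apply: powRN_le; rewrite ?quad_gt0//; rewrite /quad; move: sx; lra.
by apply: powRN_le => //; move: L9; lra.
Qed.

Lemma integral_bubble_pow_ge (s r : R) : 0 < s -> 0 <= r -> L * N%:R * r ^+ 2 <= 1 ->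
  ((bubble_core `^ s * (2 * r) ^+ N)%:E <= I s)%E.
Proof.
move=> s0 r0 Lr.
have mC := @measurable_cube R N r.
apply: (@le_trans _ _ (\int[mu]_x ((bubble_core `^ s)%:E * (\1_(cube r) x)%:E))%E).
  rewrite ge0_integralZl_EFin ?powR_ge0//; last exact/measurable_EFinP.
  rewrite integral_indic// setIT.
  by have /= -> := @lebesgue_cube R N r r0; rewrite EFinM.
apply: ge0_le_integral => //.
- by move=> x _; rewrite -EFinM lee_fin mulr_ge0 ?powR_ge0.
- by apply/measurable_EFinP; apply: measurable_funM.
- exact/measurable_EFinP.
move=> x _; rewrite -EFinM lee_fin indicE.
have [xc|xc] := pselect (@cube R N r x); last first.
  by rewrite memNset// mulr0 powR_ge0.
rewrite mem_set// mulr1; apply: ge0_ler_powR.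
- exact: ltW.
- by rewrite nnegrE ltW// bubble_core_gt0.
- by rewrite nnegrE.
- exact: bubble_core_le xc.
Qed.

Let ball_LnormE s : 0 < s -> ball_Lnorm s%:E bubble = ((I s) `^ s^-1)%E.
Proof.
move=> s0; rewrite /ball_Lnorm unlock; congr (_ `^ _)%E.
apply: eq_integral => x _.
by rewrite -/(U x) /= ger0_norm// poweR_EFin.
Qed.

Let I_fin s : 0 < s -> ((fine (I s))%:E = I s)%E.
Proof.
move=> s0; rewrite fineK// ge0_fin_numE//; apply: le_lt_trans (ltry _).
(* The share [g = 0] is admissible for every [s > 0], which gives finiteness. *)
by apply: (@integral_bubble_pow_le s 0); rewrite ?mulr0// mulr_ge0 ?ltW//; move: NR3; lra.
Qed.

Lemma ball_Lnorm_le (q g : R) : 0 < q -> 0 <= g -> g < 1 ->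
  N%:R * g <= q * (N%:R - 2) ->
  fine (ball_Lnorm q%:E bubble) <=
  ((2 / (1 - g) * (1 + L) `^ (- (g / 2))) ^+ N) `^ q^-1.
Proof.
move=> q0 g0 g1 gq; have IK := integral_bubble_pow_le q0 g0 g1 gq.
rewrite ball_LnormE// -I_fin// poweR_EFin /=.
have K0 : 0 <= 2 / (1 - g) * (1 + L) `^ (- (g / 2)).
  by rewrite mulr_ge0 ?powR_ge0// divr_ge0// subr_ge0 ltW.
apply: ge0_ler_powR; rewrite ?nnegrE ?exprn_ge0 ?fine_ge0//.
  by rewrite invr_ge0 ltW.
by rewrite -lee_fin I_fin.
Qed.

(* For [p = +oo] the exponent [(fine p)^-1] is [0^-1 = 0]. *)
Lemma ball_Lnorm_ge (p : \bar R) (r : R) : (0 < p)%E -> 0 < r ->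
  L * N%:R * r ^+ 2 <= 1 ->
  bubble_core * ((2 * r) ^+ N) `^ (fine p)^-1 <= fine (ball_Lnorm p bubble).
Proof.
case: p => [s s0 r0 Lr|_ r0 Lr|//].
  have s1 : 0 < s by rewrite -lte_fin.
  have core0 := ltW bubble_core_gt0.
  rewrite ball_LnormE// -I_fin// poweR_EFin /=.
  have rN0 : 0 <= (2 * r) ^+ N by rewrite exprn_ge0// mulr_ge0// ltW.
  apply: (@le_trans _ _ ((bubble_core `^ s * (2 * r) ^+ N) `^ s^-1)).
    by rewrite powRM ?powR_ge0// -powRrM divff ?gt_eqF// powRr1.
  apply: ge0_ler_powR; rewrite ?nnegrE ?mulr_ge0 ?powR_ge0 ?fine_ge0//.
    by rewrite invr_ge0 ltW.
  by rewrite -lee_fin I_fin// integral_bubble_pow_ge// ltW.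
(* Case [p = +oo]: the essential supremum is at least [bubble_core], since a cube of positive
   measure is not negligible, and at most 1. The upper bound matters because [fine] sends [+oo] to
   0. *)
rewrite /= invr0 powRr0 mulr1 /ball_Lnorm unlock.
have mC := @measurable_cube R N r.
have muC : (0 < mu (@cube R N r))%E.
  by have /= -> := @lebesgue_cube R N r (ltW r0); rewrite lte_fin exprn_gt0// mulr_gt0.
have -> : (0 < mu [set: 'rV[R]_N])%E.
  by apply: lt_le_trans muC _; apply: le_measure; rewrite ?inE.
set E := ess_sup _ _.
have E1 : (E <= 1)%E.
  apply/ess_supP; apply: aeW => x /=; rewrite -/(U x) lee_fin ger0_norm//.
  rewrite /U indicE; have [xb|xb] := pselect (unit_ball x); last first.
    by rewrite memNset// mulr0.
  rewrite mem_set// mulr1 (le_trans (bubble_le x))//.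
  rewrite -[leRHS](powRr0 (quad L x)); apply: ler_powR => //.
  exact: quad_ge1.
have EC : (bubble_core%:E <= E)%E.
  rewrite leNgt; apply/negP => EC.
  have := ess_sup_ge mu (abse \o (fun x => (U x)%:E)); rewrite -/E => aeE.
  have : mu.-negligible (@cube R N r).
    apply: negligibleS aeE => x xr /= UE.
    have : ((U x)%:E <= E)%E by move: UE; rewrite ger0_norm.
    apply/negP; rewrite -ltNge (lt_le_trans EC)// lee_fin.
    by apply: bubble_core_le xr => //; exact: ltW.
  by move=> /negligibleP -/(_ mC) mC0; rewrite mC0 ltxx in muC.
rewrite -lee_fin fineK// fin_real// (lt_le_trans _ EC) ?ltNyr//=.
by rewrite (le_lt_trans E1)// ltry.
Qed.

End bubble_norms_on_the_ball.

(** * The Dirichlet problem solved by the bubble and its radial Morse index *)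

Section bubble_problem.
Context {R : realType} (m : nat) (L : R).
Hypothesis m6 : (m <= 6)%N.
Hypothesis L9 : 9 <= L.
Local Notation N := m.+3.
Local Notation mu := (lebesgue_rV N).
Implicit Types (x : 'rV[R]_N).

Let L0 : 0 < L. Proof. by move: L9; lra. Qed.

Let N3 : 3 <= N%:R :> R. Proof. by rewrite ler_nat. Qed.

Let c : R := (1 + L) `^ (1 - N%:R / 2).

Let c0 : 0 < c.
Proof. by rewrite powR_gt0// addr_gt0. Qed.

(** Here [c] is the value subtracted in [bubble]. Since [bubble] is nonnegative on the ball,
    [trunc c] adds [c] back and recovers the pure power; elsewhere it keeps the base of the power
    positive. *)
Definition reaction (t : R) : R :=
  N%:R * (N%:R - 2) * L * trunc c t `^ ((N%:R + 2) / (N%:R - 2)).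

Let coef_ge0 : 0 <= N%:R * (N%:R - 2) * L.
Proof. by rewrite !mulr_ge0 ?(ltW L0)//; move: N3; lra. Qed.

Lemma smooth_reaction : smooth reaction.
Proof. exact: smooth_trunc_pow. Qed.

Lemma reaction_ge0 t : 0 <= reaction t.
Proof. by rewrite mulr_ge0 ?powR_ge0. Qed.

Lemma reaction_homo : {homo reaction : s t / s <= t}.
Proof. by apply: trunc_pow_homo => //; rewrite divr_ge0//; move: N3; lra. Qed.

Lemma smooth_closure_bubble : smooth_closure (@unit_ball R N) (bubble L).
Proof.
have -> : bubble L = fun x : 'rV[R]_N => quad L x `^ (1 - N%:R / 2) + cst (- c) x.
  by [].
apply: (bubble_algebra_smooth L0).
exact: bubble_add (bubble_pow _ _ _) (bubble_cst _ _ _).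
Qed.

Let trunc_bubble x : unit_ball x ->
  trunc c (bubble L x) = quad L x `^ (1 - N%:R / 2).
Proof.
move=> xb; rewrite trunc_ge0E ?bubble_ge0//.
by rewrite /bubble addrC subrK.
Qed.

Let N2n0 : N%:R - 2 != 0 :> R.
Proof. by rewrite gt_eqF//; move: N3; lra. Qed.

Lemma dirichlet_bubble : dirichlet_solution reaction (@bubble R N L).
Proof.
split=> x; last by move=> /unit_sphereE s1; rewrite /bubble /quad s1 mulr1 subrr.
move=> xb; rewrite /reaction trunc_bubble// -powRrM laplacian_quad_pow//.
rewrite (_ : (1 - N%:R / 2) * ((N%:R + 2) / (N%:R - 2)) = 1 - N%:R / 2 - 2);
  last by field.
by field.
Qed.

Lemma derive_reaction_bubble x : unit_ball x ->
  derive1 reaction (bubble L x) = potential L x.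
Proof.
move=> xb; rewrite (is_derive1_val (is_derive_scale _ (is_derive_trunc_pow c0 _ _))).
(* At nonnegative arguments the flat corrections vanish and [dtrunc] equals 1. *)
rewrite trunc_bubble// /dtrunc !flat_ge0 ?bubble_ge0// -powRrM.
rewrite (_ : (1 - N%:R / 2) * ((N%:R + 2) / (N%:R - 2) - 1) = - 2%:R); last by field.
rewrite powR_invn ?(ltW (quad_gt0 L0 _))// /potential.
have q0 : quad L x != 0 by rewrite gt_eqF// quad_gt0.
rewrite subr0 mulr0 addr0 mulr1.
by move: (N%:R : R) N2n0 => n n0; field; rewrite q0 n0.
Qed.

Lemma morse_formE (phi : 'rV[R]_N -> R) (D : 'I_N -> 'rV[R]_N -> R) :
  (forall i x, is_derive x (base i) phi (D i x)) ->
  (forall x, ~ unit_ball x -> phi x = 0 /\ forall i, D i x = 0) ->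
  morse_form reaction (bubble L) phi = (\int[mu]_x (energy L phi D x)%:E)%E.
Proof.
move=> phiD phi0.
rewrite -(@eq_integral_ball _ _ (energy L phi D)); last first.
  move=> x /phi0[px Dx]; rewrite /energy px expr0n mulr0 subr0 big1// => i _.
  by rewrite Dx expr0n.
apply: eq_integral => x; rewrite inE => xb; congr EFin.
rewrite derive_reaction_bubble// /energy sqnormE; congr (_ - _).
by apply: eq_bigr => i _; rewrite mxE /partial (is_derive_val (phiD i x)).
Qed.

Lemma radial_quad (g : R -> R) : radial (fun x : 'rV[R]_N => g (sqnorm x)).
Proof. by move=> x y xy; rewrite -!sqnormE xy. Qed.

Let scaled_bump (k : R) x : R := k * bump L x.

Let C1_0rad_scaled_bump k : C1_0rad (scaled_bump k).
Proof.
have D i x : is_derive x (base i) (scaled_bump k) (k * dbump L i x).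
  by apply: is_derive_scale; exact: is_derive_bump.
have supp : closure [set x : 'rV[R]_N | scaled_bump k x != 0] `<=`
    [set x | sqnorm x <= 4 / 9].
  rewrite closureE; apply: smallest_sub.
    have /continuous_closedP := @continuous_sqnorm R N.
    by move=> /(_ [set y | y <= 4 / 9] (@closed_le _ _)).
  move=> x /=; apply: contraNle => sx.
  by rewrite /scaled_bump (bump_support L9 (ltW sx)).1 mulr0.
split.
- split.
    by move=> x; apply: continuous_scale; exact: continuous_bump.
  move=> i; split; first by move=> x; case: (D i x).
  have -> : partial i (scaled_bump k) = fun x => k * dbump L i x.
    by apply/funext => x; exact: is_derive_val (D i x).
  by move=> x; apply: continuous_scale; exact: continuous_dbump.
- exact: (radial_quad (fun s => k * pospow m.+3 (4 - L * s))).
- apply: (subclosed_compact _ (@compact_cube R N 1)); first exact: closed_closure.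
  move=> x /supp/= sx; apply: unit_ball_cube; apply/unit_ballE.
  by apply: le_lt_trans sx _; lra.
- by move=> x /supp/= sx; apply/unit_ballE; apply: le_lt_trans sx _; lra.
Qed.

(** The closed support lies in the open ball, so [phi] vanishes in a neighbourhood of every point
    outside the ball, those of the sphere included. *)
Lemma C1_0rad_vanish (phi : 'rV[R]_N -> R) : C1_0rad phi ->
  forall x, ~ unit_ball x -> phi x = 0 /\ forall i, partial i phi x = 0.
Proof.
move=> [_ _ _ sb] x xb.
have xK : ~ closure [set y | phi y != 0] x by move=> /sb.
have near0 : \forall y \near x, phi y = 0.
  have : open_nbhs x (~` closure [set y | phi y != 0]).
    by split => //; apply: closed_openC; exact: closed_closure.
  move=> /open_nbhs_nbhs; apply: filterS => y yK.
  by apply/eqP/negP => /negP y0; apply: yK; exact: subset_closure.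
split; first exact: nbhs_singleton near0.
move=> i; apply: is_derive_val.
apply: (@near_eq_is_derive R _ _ (cst 0) phi).
by apply: filterS near0 => y ->.
Qed.

Lemma radial_morse_index_bubble : radial_morse_index reaction (@bubble R N L) 1.
Proof.
split.
- exists (range (fun k => scaled_bump k)); split.
    exists (fun=> bump L); split.
      move=> k k0 i; have /(congr1 (fun f => f 0)) := k0.
      rewrite /lincomb big_ord1/= (ord1 i) => /eqP.
      by rewrite mulf_eq0 (gt_eqF (bump0_gt0 _ _)) orbF => /eqP.
    apply/seteqP; split=> [_ [k _ <-]|_ [k _ <-]].
      by exists (fun=> k) => //; apply/funext => x; rewrite /lincomb big_ord1.
    by exists (k ord0) => //; apply/funext => x; rewrite /lincomb big_ord1.
  split=> [_ [k _ <-]//|_ [k _ <-] k0].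
  have kn0 : k != 0.
    by apply/eqP => k0'; apply: k0; apply/funext => x; rewrite /scaled_bump k0' mul0r.
  have Dk i x : is_derive x (base i) (scaled_bump k) (k * dbump L i x).
    by apply: is_derive_scale; exact: is_derive_bump.
  have Dk0 x : ~ unit_ball x -> scaled_bump k x = 0 /\ forall i, k * dbump L i x = 0.
    move=> xb; have sx : 4 / 9 <= sqnorm x.
      by rewrite leNgt; apply/negP => sx; apply/xb/unit_ballE; move: sx; lra.
    have [bx dx] := bump_support L9 sx.
    by rewrite /scaled_bump bx mulr0; split=> // i; rewrite dx mulr0.
  rewrite (morse_formE Dk Dk0).
  have -> : (fun x => (energy L (scaled_bump k) (fun i x => k * dbump L i x) x)%:E) =
      (fun x => (k ^+ 2)%:E * (energy L (bump L) (dbump L) x)%:E)%E.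
    apply/funext => x; rewrite -EFinM; congr EFin; rewrite /energy /scaled_bump.
    under eq_bigr do rewrite exprMn.
    by rewrite -mulr_sumr; ring.
  have cE : continuous (energy L (@bump R m L) (dbump L)).
    apply: continuous_energy => //; first exact: continuous_bump.
    by move=> i; exact: continuous_dbump.
  have E0 x : ~ unit_ball x -> energy L (@bump R m L) (dbump L) x = 0.
    move=> xb; have sx : 4 / 9 <= sqnorm x.
      by rewrite leNgt; apply/negP => sx; apply/xb/unit_ballE; move: sx; lra.
    have [bx dx] := bump_support L9 sx.
    rewrite /energy bx expr0n mulr0 subr0 big1// => i _; by rewrite dx expr0n.
  rewrite integralZl//; last exact: continuous_ball_integrable.
  by rewrite pmule_rlt0 ?bump_energy_lt0// lte_fin exprn_even_gt0.
- move=> k X [b [bfree XE]] [XC Xneg]; rewrite leqNgt; apply/negP => k1.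
  pose i0 : 'I_k := Ordinal (ltnW k1); pose i1 : 'I_k := Ordinal k1.
  have i10 : i1 != i0 by [].
  (* A point of the zero set of [Z]; a radial function that vanishes at [x0] vanishes on the whole
     sphere [L |x|^2 = 1]. *)
  pose x0 : 'rV[R]_N := (Num.sqrt L^-1) *: base ord0.
  have sx0 : L * sqnorm x0 = 1.
    rewrite /sqnorm (bigD1 ord0)//= big1 => [|i i0']; last first.
      by rewrite !mxE (negbTE i0') andbF mulr0 expr0n.
    rewrite !mxE !eqxx mulr1 addr0 sqr_sqrtr ?invr_ge0 ?(ltW L0)//.
    by rewrite divff// gt_eqF.
  (* Evaluation at [x0] is one linear condition on the span of [b i0] and [b i1]. If [b i0] vanishes
     at [x0] it is taken itself, which keeps the coefficients from being all zero. *)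
  have [d dphi [i di]] : exists2 d : 'I_k -> R,
      lincomb b d x0 = 0 & exists i, d i != 0.
    have [b00|b00] := eqVneq (b i0 x0) 0.
      exists (fun i => (i == i0)%:R); last by exists i0; rewrite eqxx oner_neq0.
      rewrite /lincomb (bigD1 i0)//= b00 mulr0 add0r big1// => i ii0.
      by rewrite (negbTE ii0) mul0r.
    exists (fun i => if i == i0 then b i1 x0 else if i == i1 then - b i0 x0 else 0).
      rewrite /lincomb (bigD1 i0)//= (bigD1 i1)//=.
      rewrite big1 => [|i /andP[ii0 ii1]]; first by rewrite addr0; ring.
      by rewrite (negbTE ii0) (negbTE ii1) mul0r.
    by exists i1; rewrite (negbTE i10) eqxx oppr_eq0.
  pose phi := lincomb b d.
  have Xphi : X phi by rewrite XE; exists d.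
  have phin0 : phi <> cst 0 by move=> /bfree/(_ i)/eqP; apply/negP.
  have Cphi := XC _ Xphi; have [[cphi dphi'] rphi _ _] := Cphi.
  have := Xneg _ Xphi phin0; apply/negP; rewrite -leNgt.
  have D j x : is_derive x (base j) phi (partial j phi x).
    by have [/(_ x) H _] := dphi' j; exact: derivableP.
  rewrite (morse_formE D (C1_0rad_vanish Cphi)).
  apply: energy_ge0 => //.
  + by move=> j; have [] := dphi' j.
  + exact: C1_0rad_vanish.
  + move=> x Lx; rewrite -dphi; apply: rphi; rewrite /enorm; congr Num.sqrt.
    have Ln0 : L != 0 by rewrite gt_eqF.
    by apply: (mulfI Ln0); rewrite -/(sqnorm x) -/(sqnorm x0) Lx.
Qed.

End bubble_problem.

(** * Growth of the quotient of norms as [L] tends to infinity *)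

Section concentration.
Context {R : realType} (N : nat).
Hypothesis N3 : (3 <= N)%N.

Let NR3 : 3 <= N%:R :> R. Proof. by rewrite ler_nat. Qed.

(** The numerator is at least of order [L^(-N / (2p))] and the denominator at most of order
    [L^(-N g / (2q))]. For [p = +oo] the terms in [fine p] vanish, by [0^-1 = 0]. *)
Lemma ball_Lnorm_ratio_ge (p : \bar R) (q g L : R) :
  (0 < p)%E -> 0 < q -> 0 <= g -> g < 1 -> N%:R * g <= q * (N%:R - 2) -> 9 <= L ->
  bubble_core N * 2 `^ (N%:R / fine p) * N%:R `^ (- (N%:R / (2 * fine p)))
    / (2 / (1 - g)) `^ (N%:R / q) * L `^ (N%:R / 2 * (g / q - (fine p)^-1)) <=
  fine (ball_Lnorm p (@bubble R N L)) / fine (ball_Lnorm q%:E (@bubble R N L)).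
Proof.
move=> p0 q0 g0 g1 gq L9; have L0 : 0 < L by move: L9; lra.
have N0 : 0 < N%:R :> R by move: NR3; lra.
have LN0 : 0 < L * N%:R by rewrite mulr_gt0.
(* The half-side of the largest cube contained in [L |x|^2 <= 1]. *)
pose r := (L * N%:R) `^ (- 2^-1).
have r0 : 0 < r by rewrite powR_gt0.
have Lr : L * N%:R * r ^+ 2 <= 1.
  rewrite -powR_mulrn ?powR_ge0// -powRrM mulNr mulVf// powR_inv1 ?(ltW LN0)//.
  by rewrite mulfV ?gt_eqF.
have K0 : 0 < 2 / (1 - g) by rewrite divr_gt0// subr_gt0.
(* Stated for any exponent: at [p] it bounds the numerator, at [q] it shows that the denominator is
   positive. *)
have low t : (0 < t)%E -> bubble_core N * (2 `^ (N%:R / fine t) *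
    (L * N%:R) `^ (- (N%:R / (2 * fine t)))) <= fine (ball_Lnorm t (@bubble R N L)).
  move=> t0; apply: le_trans (ball_Lnorm_ge N3 L9 t0 r0 Lr).
  rewrite le_eqVlt; apply/orP; left; apply/eqP; congr (_ * _).
  rewrite -powR_mulrn ?mulr_ge0 ?(ltW r0)// -powRrM [RHS]powRM ?(ltW r0)//; congr (_ * _).
  by rewrite /r -powRrM; congr (_ `^ _); rewrite invfM; ring.
have up : fine (ball_Lnorm q%:E (@bubble R N L)) <=
    (2 / (1 - g)) `^ (N%:R / q) * L `^ (- (N%:R / 2 * (g / q))).
  apply: le_trans (ball_Lnorm_le N3 L9 q0 g0 g1 gq) _.
  have KL : 0 <= 2 / (1 - g) * (1 + L) `^ (- (g / 2)).
    by rewrite mulr_ge0 ?powR_ge0// ltW.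
  rewrite -powR_mulrn// -powRrM powRM ?powR_ge0 ?(ltW K0)// ler_wpM2l ?powR_ge0// -powRrM.
  have -> : - (g / 2) * (N%:R / q) = - (N%:R / 2 * (g / q)) by ring.
  rewrite !powRN lef_pV2 ?posrE ?powR_gt0//; last by rewrite addr_gt0.
  apply: ge0_ler_powR; rewrite ?nnegrE ?addr_ge0 ?(ltW L0)//; last by rewrite lerDr.
  by rewrite mulr_ge0// divr_ge0// ltW.
have q_pos : 0 < fine (ball_Lnorm q%:E (@bubble R N L)).
  apply: lt_le_trans (low q%:E _); last by rewrite lte_fin.
  by rewrite !mulr_gt0 ?powR_gt0// bubble_core_gt0.
rewrite ler_pdivlMr//; apply: le_trans (low p p0).
have A0 : 0 <= bubble_core N * 2 `^ (N%:R / fine p) * N%:R `^ (- (N%:R / (2 * fine p)))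
    / (2 / (1 - g)) `^ (N%:R / q) * L `^ (N%:R / 2 * (g / q - (fine p)^-1)).
  by rewrite !mulr_ge0 ?invr_ge0 ?powR_ge0// ltW// bubble_core_gt0.
apply: le_trans (ler_wpM2l A0 up) _.
rewrite le_eqVlt; apply/orP; left; apply/eqP.
rewrite powRM ?(ltW L0) ?(ltW N0)//.
have -> : L `^ (N%:R / 2 * (g / q - (fine p)^-1)) =
    L `^ (N%:R / 2 * (g / q)) * L `^ (- (N%:R / (2 * fine p))).
  rewrite -powRD ?(gt_eqF L0) ?implybT//; congr (_ `^ _).
  by rewrite invfM; ring.
rewrite (powRN L (N%:R / 2 * (g / q))).
have LP : L `^ (N%:R / 2 * (g / q)) != 0 by rewrite gt_eqF ?powR_gt0.
have KP : (2 / (1 - g)) `^ (N%:R / q) != 0 by rewrite gt_eqF ?powR_gt0.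
move: (_ `^ (N%:R / q)) KP (_ `^ (N%:R / 2 * (g / q))) LP => k k0 l l0.
by field; rewrite k0 l0.
Qed.

Lemma powR_nat_cvgy (C e : R) : 0 < C -> 0 < e ->
  (C * (n + 9)%:R `^ e) @[n --> \oo] --> +oo.
Proof.
move=> C0 e0; apply/cvgryPge => A.
have := nbhs_infty_ger ((`|A| / C) `^ e^-1); apply: filterS => n An.
rewrite -ler_pdivrMl// mulrC; apply: (@le_trans _ _ (`|A| / C)).
  by rewrite ler_wpM2r ?invr_ge0 ?(ltW C0)// ler_norm.
have -> : `|A| / C = ((`|A| / C) `^ e^-1) `^ e.
  by rewrite -powRrM mulVf ?powRr1 ?(gt_eqF e0)// divr_ge0// ltW.
apply: ge0_ler_powR.
- exact: ltW.
- by rewrite nnegrE powR_ge0.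
- by rewrite nnegrE.
- by rewrite (le_trans An)// ler_nat leq_addr.
Qed.

End concentration.

Theorem theorem2p1 (R : realType) (N : nat) (hN3 : (3 <= N)%N)
    (hN9 : (N <= 9)%N) (q : R) (p : \bar R) (hq : 1 <= q) (hqp : (q%:E < p)%E)
    (hp : ((N%:R / (N%:R - 2%:R))%:E < p)%E) :
  exists (f : nat -> R -> R) (u : nat -> 'rV[R]_N -> R),
    (forall n,
      [/\ smooth (f n),
          forall t, 0 <= f n t &
          {homo f n : s t / s <= t}]) /\
    (forall n,
      [/\ smooth_closure (@unit_ball R N) (u n),
          dirichlet_solution (f n) (u n) &
          radial_morse_index (f n) (u n) 1%N]) /\
    (fine (ball_Lnorm p (u n)) / fine (ball_Lnorm q%:E (u n)))
      @[n --> \oo] --> +oo.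
Proof.
have q0 : 0 < q by exact: lt_le_trans hq.
have p0 : (0 < p)%E by apply: lt_trans hqp; rewrite lte_fin.
have NR : 3 <= N%:R :> R by rewrite ler_nat.
(* The last condition makes the exponent of [L] positive. For finite [p] the hypotheses [q < p] and
   [p > N / (N - 2)] say that [q / p] is less than 1 and than [q (N - 2) / N]; for [p = +oo] the
   quotient is 0. The midpoint between [q / p] and the smaller bound is taken. *)
have [g [g0 g1 gN gp]] : exists g : R, [/\ 0 <= g, g < 1,
    N%:R * g <= q * (N%:R - 2) & q / fine p < g].
  have lt1 : q / fine p < 1.
    case: p hqp {hp p0} => [s|_|//]; last by rewrite /= invr0 mulr0.
    by rewrite lte_fin => qs; rewrite ltr_pdivrMr ?mul1r// (lt_trans q0).
  have lt2 : q / fine p < q * (N%:R - 2) / N%:R.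
    case: p hp p0 {hqp lt1} => [s|_ _|//]; last first.
      by rewrite /= invr0 mulr0 divr_gt0 ?mulr_gt0//; move: NR; lra.
    rewrite !lte_fin => Ns s0 /=.
    rewrite -mulrA ltr_pM2l// -[ltRHS]invf_div ltf_pV2// posrE.
    by rewrite divr_gt0//; move: NR; lra.
  have s0 : 0 <= q / fine p by rewrite divr_ge0 ?(ltW q0)// fine_ge0// ltW.
  set s := q / fine p in lt1 lt2 s0 *; set t := q * (N%:R - 2) / N%:R in lt2.
  have tE : q * (N%:R - 2) = N%:R * t by rewrite /t; field; move: NR; lra.
  exists ((s + Num.min 1 t) / 2); rewrite tE ler_pM2l; last by move: NR; lra.
  have : s < Num.min 1 t by rewrite lt_min lt1.
  have : Num.min 1 t <= 1 by rewrite ge_min lexx.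
  have : Num.min 1 t <= t by rewrite ge_min lexx orbT.
  move: (Num.min 1 t) => w wt w1 sw.
  by split; move: wt w1 sw s0; lra.
(* The sequence is [L = n + 9], shifted so that [L >= 9] holds from the first term. *)
have L9 n : 9 <= (n + 9)%:R :> R by rewrite ler_nat leq_addl.
have [C C0 ratio] : exists2 C : R, 0 < C & forall n,
    C * (n + 9)%:R `^ (N%:R / 2 * (g / q - (fine p)^-1)) <=
    fine (ball_Lnorm p (@bubble R N (n + 9)%:R)) /
    fine (ball_Lnorm q%:E (@bubble R N (n + 9)%:R)).
  exists (bubble_core N * 2 `^ (N%:R / fine p) * N%:R `^ (- (N%:R / (2 * fine p)))
      / (2 / (1 - g)) `^ (N%:R / q)); last first.
    by move=> n; apply: ball_Lnorm_ratio_ge.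
  have N0 : 0 < N%:R :> R by move: NR; lra.
  by rewrite !mulr_gt0 ?invr_gt0 ?powR_gt0 ?bubble_core_gt0// divr_gt0// subr_gt0.
have ratioy : (fine (ball_Lnorm p (@bubble R N (n + 9)%:R)) /
    fine (ball_Lnorm q%:E (@bubble R N (n + 9)%:R))) @[n --> \oo] --> +oo.
  apply: (@ger_cvgy _ _ _ _ (fun n => C * (n + 9)%:R `^ (N%:R / 2 * (g / q - (fine p)^-1)))).
    by apply: nearW.
  apply: powR_nat_cvgy => //; rewrite mulr_gt0//; first by move: NR; lra.
  by rewrite subr_gt0 ltr_pdivlMr// mulrC.
case: N hN3 hN9 {hp NR gN C C0 ratio} ratioy => [|[|[|m]]]// _ m6 ratioy.
exists (fun n => @reaction R m (n + 9)%:R), (fun n => bubble (n + 9)%:R).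
split=> [n|]; last split=> // n.
- split; first exact: smooth_reaction.
  + exact: reaction_ge0.
  + exact: reaction_homo.
- split; first exact: smooth_closure_bubble.
  + exact: dirichlet_bubble.
  + exact: radial_morse_index_bubble.
Qed.
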